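(* Let $\alpha>-1$. (i) If $\alpha>0$, then for every $n\ge0$, $\|\ell_n^{(\alpha)}\|_\infty\le\|\ell_{n+1}^{(\alpha-1)}\|_1$. (ii) $\ell_n^{(\alpha)}\in L^1(\mathbb R_+)$ for all $n\ge0$, and there is a constant $C_\alpha>0$ such that for all $n\ge1$, $$\max_{t\in\mathcal Z(L_n^{(\alpha)})}|\ell_{n-1}^{(\alpha)}(t)|\le\|\ell_n^{(\alpha)}\|_1\le\frac{C_\alpha}{n^{\alpha/2}},$$ where $\mathcal Z(L_n^{(\alpha)})$ is the set of zeros of $L_n^{(\alpha)}$. (iii) Let $p\ge1$ and $\alpha>-\frac1p$. Then $\ell_n^{(\alpha)}\in L^p(\mathbb R_+)$ for all $n\ge0$, and there is $C_{p,\alpha}>0$ with $\|\ell_n^{(\alpha)}\|_p\le C_{p,\alpha}\,n^{1/2}$ for all $n\ge1$.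
   Context: $L_n^{(\alpha)}(t)=\sum_{k=0}^n(-1)^k\binom{n+\alpha}{n-k}\frac{t^k}{k!}$ is the generalized Laguerre polynomial, and $\ell_n^{(\alpha)}(t):=\frac{n!}{\Gamma(n+\alpha+1)}t^{\alpha}e^{-t}L_n^{(\alpha)}(t)$ for $t>0$. $\|\cdot\|_p$ denotes the norm of $L^p(\mathbb R_+)$, $\mathbb R_+=[0,\infty)$, and $\|\cdot\|_\infty$ the essential supremum norm. *)

(* Defs.v *)
From Stdlib Require Import Reals Lra Arith ClassicalEpsilon.
From Stdlib Require Import Factorial.
Open Scope R_scope.

Fixpoint falling (x : R) (m : nat) : R :=
  match m with
  | O => 1
  | S m' => falling x m' * (x - INR m')
  end.
Definition gbinom (x : R) (m : nat) : R := falling x m / INR (fact m).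

Definition laguerre (n : nat) (alpha t : R) : R :=
  sum_f_R0 (fun k => (-1) ^ k * gbinom (INR n + alpha) (n - k)
                       * t ^ k / INR (fact k)) n.

Definition has_improper_integral (f : R -> R) (l : R) : Prop :=
  (forall a b, 0 < a -> a <= b -> inhabited (Riemann_integrable f a b)) /\
  (forall eps, 0 < eps -> exists d, 0 < d /\ exists M,
     forall a b (pr : Riemann_integrable f a b),
       0 < a -> a < d -> a <= b -> M < b -> Rabs (RiemannInt pr - l) < eps).

(* The value of the improper integral (meaningful when it exists). *)
Definition integral (f : R -> R) : R :=
  epsilon (inhabits 0) (fun l => has_improper_integral f l).

Definition Gamma (s : R) : R :=
  integral (fun t => Rpower t (s - 1) * exp (- t)).

Definition powabs (x p : R) : R :=
  if Rlt_dec 0 (Rabs x) then Rpower (Rabs x) p else 0.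

(* f in L^p(R_+) (for f continuous on (0,oo)). *)
Definition in_Lp (f : R -> R) (p : R) : Prop :=
  exists l, has_improper_integral (fun t => powabs (f t) p) l.

Definition Lp_norm (f : R -> R) (p : R) : R :=
  powabs (integral (fun t => powabs (f t) p)) (1 / p).

Definition ell (n : nat) (alpha t : R) : R :=
  INR (fact n) / Gamma (INR n + alpha + 1) * Rpower t alpha * exp (- t)
  * laguerre n alpha t.

(* Main.v *)
From Stdlib Require Import Reals Lra Lia Factorial ClassicalEpsilon.
From Coquelicot Require Import Coquelicot.
Require Import Defs.
Open Scope R_scope.

(** Write [h = n! / Gamma(n+alpha+1)] and [w = t^alpha e^(-t)], so that
    [ell n alpha = h w L] with [L] the Laguerre polynomial.

    - Since [(ell n (alpha+1))' = ell (n+1) alpha] and [ell n (alpha+1)] vanishes at [0],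
      the sup norm of [ell n (alpha+1)] is at most the L^1 norm of [ell (n+1) alpha].
      Moreover [ell n (alpha+1) = ell n alpha - ell (n+1) alpha], which equals
      [ell n alpha] at the zeros of the Laguerre polynomial of degree [n+1].
    - Integrating by parts [n] times, [w L^2] has integral [1/h], and [h] is
      [O(n^(-alpha))]. The upper bound on the L^1 norm is then Cauchy-Schwarz.
    - For the L^p norm, the integral of [ell^2 / w] is [h]. It controls [|ell|^p] where
      [|ell|] exceeds a multiple of [sqrt n t^alpha e^(-t/2)], given an a priori pointwise
      bound: for [alpha >= -1/2] a Sonin-type energy gives [|ell| <= t^alpha / Gamma(alpha+1)];
      for [alpha < -1/2] (hence [p < 2]) the mean value theorem gives
      [|ell| = O(t^alpha)] on [(0, 1/n]], which suffices. *)

(** * Elementary bounds on powers, exponentials and logarithms *)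

Lemma ln_le_sub1 x : 0 < x -> ln x <= x - 1.
Proof.
intros hx. pose proof (exp_ineq1_le (ln x)) as h. rewrite exp_ln in h; lra.
Qed.

Lemma Rpower_pos x y : 0 < Rpower x y.
Proof. apply exp_pos. Qed.

Lemma exp_le a b : a <= b -> exp a <= exp b.
Proof. intros [h| ->]; [left; now apply exp_increasing | lra]. Qed.

(** The inequality [ln x <= x - 1] at [x = c t / s] makes [(s / c)^s] an admissible constant. *)
Lemma Rpower_le_exp s c : 0 < s -> 0 < c ->
  exists K, 0 < K /\ forall t, 0 < t -> Rpower t s <= K * exp (c * t).
Proof.
intros hs hc. exists (exp (s * ln (s / c))). split; [apply exp_pos|].
intros t ht. unfold Rpower. rewrite <- exp_plus. apply exp_le.
assert (hsc : 0 < s / c) by now apply Rdiv_lt_0_compat.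
assert (h : ln t = ln (c * t / s) + ln (s / c)).
{ rewrite <- ln_mult; [f_equal; field; lra | | easy].
  apply Rdiv_lt_0_compat; nra. }
assert (h0 : 0 < c * t / s) by (apply Rdiv_lt_0_compat; nra).
pose proof (ln_le_sub1 _ h0) as h1.
assert (h2 : s * (c * t / s) = c * t) by (field; lra).
rewrite h. nra.
Qed.

Lemma Rpower_le_exp_ge1 s c : 0 < c ->
  exists K, 0 < K /\ forall t, 1 <= t -> Rpower t s <= K * exp (c * t).
Proof.
intros hc.
(* The exponent is raised to a positive one, which only increases the power when [t >= 1]. *)
destruct (Rpower_le_exp (Rabs s + 1) c) as [K [hK h]]; [pose proof (Rabs_pos s); lra | easy |].
exists K; split; [easy|]. intros t ht.
eapply Rle_trans; [|apply h; lra].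
destruct ht as [ht| <-].
- apply Rle_Rpower; [lra|]. pose proof (Rle_abs s). lra.
- unfold Rpower. rewrite ln_1, !Rmult_0_r. lra.
Qed.

Lemma is_derive_Rpower t s : 0 < t ->
  is_derive (fun u => Rpower u s) t (s * Rpower t (s - 1)).
Proof. intros ht. apply is_derive_Reals. now apply derivable_pt_lim_power. Qed.

Lemma Rpower_sub1 t s : 0 < t -> t * Rpower t (s - 1) = Rpower t s.
Proof.
intros ht. rewrite <- (Rpower_1 t) at 1 by easy.
rewrite <- Rpower_plus. f_equal. ring.
Qed.

Lemma Rpower_lt_near0 s e : 0 < s -> 0 < e ->
  exists d, 0 < d /\ forall t, 0 < t -> t < d -> Rpower t s < e.
Proof.
intros hs he. exists (Rpower e (/ s)). split; [apply exp_pos|].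
intros t ht htd.
replace e with (Rpower (Rpower e (/ s)) s).
- unfold Rpower at 1 2. apply exp_increasing. apply Rmult_lt_compat_l; [easy|].
  now apply ln_increasing.
- rewrite Rpower_mult, Rinv_l by lra. now apply Rpower_1.
Qed.

(** * Improper integrals over the positive half-line *)

(** The point [0] is left out because [t^alpha] may be singular there when [alpha < 0]. *)
Definition continuous_pos (f : R -> R) : Prop := forall t, 0 < t -> continuous f t.

Lemma ex_RInt_pos f a b : continuous_pos f -> 0 < a -> a <= b -> ex_RInt f a b.
Proof.
intros hf ha hab. apply @ex_RInt_continuous. intros z hz.
rewrite Rmin_left in hz by easy. apply hf. lra.
Qed.

(** Passage to the total function [RInt]: continuity supplies integrability on compact intervals, so
    no integrability proofs have to be carried along. *)
Lemma has_improper_integral_RInt f l : continuous_pos f ->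
  has_improper_integral f l <->
  (forall eps, 0 < eps -> exists d, 0 < d /\ exists M,
     forall a b, 0 < a -> a < d -> a <= b -> M < b -> Rabs (RInt f a b - l) < eps).
Proof.
intros hf. split.
- intros [_ h] eps heps. destruct (h eps heps) as [d [hd [M hM]]].
  exists d; split; [easy|]. exists M. intros a b h1 h2 h3 h4.
  pose (pr := ex_RInt_Reals_0 f a b (ex_RInt_pos f a b hf h1 h3)).
  rewrite (RInt_Reals f a b pr). now apply hM.
- intros h. split.
  + intros a b ha hab. constructor. apply ex_RInt_Reals_0. now apply ex_RInt_pos.
  + intros eps heps. destruct (h eps heps) as [d [hd [M hM]]].
    exists d; split; [easy|]. exists M. intros a b pr h1 h2 h3 h4.
    rewrite <- RInt_Reals. now apply hM.
Qed.

(** Supplies one interval that lies beyond the thresholds of two convergence statements at once. *)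
Lemma common_bounds d1 d2 M1 M2 : 0 < d1 -> 0 < d2 ->
  exists a b, 0 < a /\ a < d1 /\ a < d2 /\ a <= b /\ M1 < b /\ M2 < b.
Proof.
intros h1 h2. pose proof (Rmin_l d1 d2). pose proof (Rmin_r d1 d2).
assert (0 < Rmin d1 d2) by now apply Rmin_glb_lt.
exists (Rmin d1 d2 / 2), (Rmin d1 d2 / 2 + Rabs M1 + Rabs M2 + 1).
pose proof (Rle_abs M1). pose proof (Rle_abs M2).
pose proof (Rabs_pos M1). pose proof (Rabs_pos M2). repeat split; lra.
Qed.

Lemma improper_le f g lf lg : continuous_pos f -> continuous_pos g ->
  (forall t, 0 < t -> f t <= g t) ->
  has_improper_integral f lf -> has_improper_integral g lg -> lf <= lg.
Proof.
intros cf cg hfg hf hg. apply Rnot_lt_le. intros hl.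
rewrite (has_improper_integral_RInt f lf cf) in hf.
rewrite (has_improper_integral_RInt g lg cg) in hg.
destruct (hf ((lf - lg) / 2)) as [d1 [hd1 [M1 h1]]]; [lra|].
destruct (hg ((lf - lg) / 2)) as [d2 [hd2 [M2 h2]]]; [lra|].
destruct (common_bounds d1 d2 M1 M2) as (a & b & ha & ha1 & ha2 & hab & hb1 & hb2); try easy.
specialize (h1 a b ha ha1 hab hb1). specialize (h2 a b ha ha2 hab hb2).
assert (RInt f a b <= RInt g a b).
{ apply RInt_le; [easy | now apply ex_RInt_pos | now apply ex_RInt_pos |].
  intros x hx. apply hfg. lra. }
apply Rabs_def2 in h1. apply Rabs_def2 in h2. lra.
Qed.

Lemma improper_unique f l l' : continuous_pos f ->
  has_improper_integral f l -> has_improper_integral f l' -> l = l'.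
Proof.
intros cf h h'. apply Rle_antisym.
- now apply (improper_le f f l l' cf cf) ; [intros; lra | |].
- now apply (improper_le f f l' l cf cf) ; [intros; lra | |].
Qed.

(** [integral] is chosen by [epsilon], so its value is known only through existence and uniqueness
    of the limit. *)
Lemma integral_eq f l : continuous_pos f -> has_improper_integral f l -> integral f = l.
Proof.
intros cf h. apply (improper_unique f); [easy| |easy].
unfold integral. apply epsilon_spec. now exists l.
Qed.

Lemma continuous_pos_lin f g c d : continuous_pos f -> continuous_pos g ->
  continuous_pos (fun t => c * f t + d * g t).
Proof.
intros cf cg t ht. apply (continuous_plus (fun u => c * f u) (fun u => d * g u)).
- apply (continuous_scal_r c f). now apply cf.
- apply (continuous_scal_r d g). now apply cg.
Qed.

Lemma improper_lin f g lf lg c d : continuous_pos f -> continuous_pos g ->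
  has_improper_integral f lf -> has_improper_integral g lg ->
  has_improper_integral (fun t => c * f t + d * g t) (c * lf + d * lg).
Proof.
intros cf cg hf hg.
rewrite (has_improper_integral_RInt f lf cf) in hf.
rewrite (has_improper_integral_RInt g lg cg) in hg.
apply has_improper_integral_RInt; [now apply continuous_pos_lin|]. intros eps heps.
set (e := eps / (2 * (Rabs c + Rabs d + 1))).
pose proof (Rabs_pos c). pose proof (Rabs_pos d).
assert (he : 0 < e) by (unfold e; apply Rdiv_lt_0_compat; lra).
destruct (hf e he) as [d1 [hd1 [M1 h1]]].
destruct (hg e he) as [d2 [hd2 [M2 h2]]].
exists (Rmin d1 d2). split; [now apply Rmin_glb_lt|].
exists (Rmax M1 M2). intros a b ha had hab hb.
assert (ha1 : a < d1) by (pose proof (Rmin_l d1 d2); lra).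
assert (ha2 : a < d2) by (pose proof (Rmin_r d1 d2); lra).
assert (hb1 : M1 < b) by (pose proof (Rmax_l M1 M2); lra).
assert (hb2 : M2 < b) by (pose proof (Rmax_r M1 M2); lra).
specialize (h1 a b ha ha1 hab hb1). specialize (h2 a b ha ha2 hab hb2).
replace (RInt (fun t => c * f t + d * g t) a b) with (c * RInt f a b + d * RInt g a b).
2:{ symmetry. apply is_RInt_unique.
    apply (is_RInt_plus (V := R_NormedModule) (fun t => c * f t) (fun t => d * g t)).
    - apply (is_RInt_scal (V := R_NormedModule) f). apply (RInt_correct (V := R_CompleteNormedModule)).
      now apply ex_RInt_pos.
    - apply (is_RInt_scal (V := R_NormedModule) g). apply (RInt_correct (V := R_CompleteNormedModule)).
      now apply ex_RInt_pos. }
replace (c * RInt f a b + d * RInt g a b - (c * lf + d * lg))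
  with (c * (RInt f a b - lf) + d * (RInt g a b - lg)) by ring.
eapply Rle_lt_trans; [apply Rabs_triang|]. rewrite !Rabs_mult.
assert (e * (2 * (Rabs c + Rabs d + 1)) = eps) by (unfold e; field; lra).
nra.
Qed.

Lemma improper_ext f g l : continuous_pos f -> (forall t, 0 < t -> f t = g t) ->
  has_improper_integral f l -> has_improper_integral g l.
Proof.
intros cf hfg hf.
assert (cg : continuous_pos g).
{ intros t ht. apply (continuous_ext_loc g f); [|now apply cf].
  exists (mkposreal t ht). intros y hy. apply hfg.
  apply Rabs_def2 in hy. unfold minus, plus, opp in hy; simpl in hy. lra. }
apply has_improper_integral_RInt; [easy|].
rewrite (has_improper_integral_RInt f l cf) in hf. intros eps heps.
destruct (hf eps heps) as [d [hd [M h]]]. exists d; split; [easy|]. exists M.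
intros a b h1 h2 h3 h4. rewrite <- (RInt_ext f g); [now apply h|].
intros x hx. rewrite Rmin_left in hx by easy. apply hfg. lra.
Qed.

Lemma RInt_pos_le_mono f a a' b b' : continuous_pos f -> (forall t, 0 < t -> 0 <= f t) ->
  0 < a' -> a' <= a -> a <= b -> b <= b' -> RInt f a b <= RInt f a' b'.
Proof.
intros cf pf h0 h1 h2 h3.
assert (e1 : ex_RInt f a' a) by now apply ex_RInt_pos.
assert (e2 : ex_RInt f a b) by (apply ex_RInt_pos; [easy|lra|easy]).
assert (e3 : ex_RInt f b b') by (apply ex_RInt_pos; [easy|lra|easy]).
rewrite <- (RInt_Chasles f a' b b'); [|now apply ex_RInt_Chasles with a|easy].
rewrite <- (RInt_Chasles f a' a b) by easy.
assert (0 <= RInt f a' a) by (apply RInt_ge_0; [easy|easy|intros x hx; apply pf; lra]).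
assert (0 <= RInt f b b') by (apply RInt_ge_0; [easy|easy|intros x hx; apply pf; lra]).
unfold plus; simpl. lra.
Qed.

(** For a nonnegative integrand the integral over [[a, b]] grows with the interval, so the limit is
    the supremum over all such intervals. *)
Lemma improper_ex f B : continuous_pos f -> (forall t, 0 < t -> 0 <= f t) ->
  (forall a b, 0 < a -> a <= b -> RInt f a b <= B) ->
  exists l, has_improper_integral f l.
Proof.
intros cf pf hB.
destruct (completeness (fun v => exists a b, 0 < a /\ a <= b /\ v = RInt f a b)) as [l [hl1 hl2]].
- exists B. intros v (a & b & ha & hab & ->). now apply hB.
- exists (RInt f 1 1), 1, 1. repeat split; lra.
- exists l. apply has_improper_integral_RInt; [easy|]. intros eps heps.
  destruct (classic (exists a b, 0 < a /\ a <= b /\ l - eps < RInt f a b)) as [h|h].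
  + destruct h as (a0 & b0 & ha & hab & h). exists a0; split; [easy|]. exists b0.
    intros a b h1 h2 h3 h4. apply Rabs_def1.
    * assert (RInt f a b <= l) by (apply hl1; now exists a, b). lra.
    * assert (RInt f a0 b0 <= RInt f a b) by (apply RInt_pos_le_mono; try easy; lra). lra.
  + exfalso. assert (l <= l - eps); [|lra]. apply hl2.
    intros v (a & b & ha & hab & ->). apply Rnot_lt_le. intros hv. apply h. now exists a, b.
Qed.

Lemma RInt_le_improper f l a b : continuous_pos f -> (forall t, 0 < t -> 0 <= f t) ->
  has_improper_integral f l -> 0 < a -> a <= b -> RInt f a b <= l.
Proof.
intros cf pf hf ha hab. apply Rnot_lt_le. intros hl.
rewrite (has_improper_integral_RInt f l cf) in hf.
destruct (hf (RInt f a b - l)) as [d [hd [M h]]]; [lra|].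
destruct (common_bounds d a M b hd ha) as (a1 & b1 & h1 & h2 & h3 & h4 & h5 & h6).
specialize (h a1 b1 h1 h2 h4 h5). apply Rabs_def2 in h.
assert (RInt f a b <= RInt f a1 b1) by (apply RInt_pos_le_mono; try easy; lra). lra.
Qed.

Lemma improper_ge0 f l : continuous_pos f -> (forall t, 0 < t -> 0 <= f t) ->
  has_improper_integral f l -> 0 <= l.
Proof.
intros cf pf hf. pose proof (RInt_le_improper f l 1 1 cf pf hf) as h.
rewrite RInt_point in h. apply h; lra.
Qed.

Lemma is_derive_continuous_pos f df :
  (forall t, 0 < t -> is_derive f t (df t)) -> continuous_pos f.
Proof. intros h t ht. apply (@ex_derive_continuous R_AbsRing R_NormedModule). exists (df t). now apply h. Qed.

Lemma RInt_derive_pos (F f : R -> R) a b : continuous_pos f ->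
  (forall t, 0 < t -> is_derive F t (f t)) -> 0 < a -> a <= b -> RInt f a b = F b - F a.
Proof.
intros cf hF ha hab. apply is_RInt_unique.
apply (is_RInt_derive (V := R_CompleteNormedModule) F f); intros x; rewrite Rmin_left by easy; intros hx.
- apply hF. lra.
- apply cf. lra.
Qed.

Lemma continuous_pos_mult f g :
  continuous_pos f -> continuous_pos g -> continuous_pos (fun t => f t * g t).
Proof. intros cf cg t ht. apply (continuous_mult f g); [now apply cf | now apply cg]. Qed.

Lemma continuous_pos_const c : continuous_pos (fun _ => c).
Proof. intros t _. apply continuous_const. Qed.

Lemma continuous_pos_Rpower s : continuous_pos (fun t => Rpower t s).
Proof.
apply is_derive_continuous_pos with (fun t => s * Rpower t (s - 1)).
intros t ht. now apply is_derive_Rpower.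
Qed.

Lemma continuous_pos_exp c : continuous_pos (fun t => exp (c * t)).
Proof.
apply is_derive_continuous_pos with (fun t => c * exp (c * t)).
intros t _. auto_derive; [easy|ring].
Qed.

(* [t^s e^(-ct)] is dominated by a multiple of the derivative of the bounded
   function [t^(s+1) / (1 + t^(s+1))]. *)
Lemma improper_ex_dominated f K s c : continuous_pos f -> (forall t, 0 < t -> 0 <= f t) ->
  -1 < s -> 0 < c ->
  (forall t, 0 < t -> f t <= K * (Rpower t s * exp (- (c * t)))) ->
  exists l, has_improper_integral f l.
Proof.
intros cf pf hs hc hf.
assert (hK : 0 <= K).
{ specialize (pf 1 Rlt_0_1). specialize (hf 1 Rlt_0_1).
  pose proof (Rmult_lt_0_compat _ _ (Rpower_pos 1 s) (exp_pos (- (c * 1)))). nra. }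
set (r := s + 1). assert (hr : 0 < r) by (unfold r; lra).
destruct (Rpower_le_exp r (c / 2)) as [A [hA hAt]]; [easy|lra|].
set (phi := fun t => Rpower t r / (1 + Rpower t r)).
set (dphi := fun t => r * Rpower t s / (1 + Rpower t r) ^ 2).
assert (hphi : forall t, 0 < t -> is_derive phi t (dphi t)).
{ intros t ht. pose proof (Rpower_pos t r).
  pose proof (is_derive_Rpower t r ht) as hd.
  evar_last.
  - apply (is_derive_div (fun u => Rpower u r) (fun u => 1 + Rpower u r)); [exact hd| |lra].
    apply (is_derive_plus (fun _ => 1) (fun u => Rpower u r)); [|exact hd].
    apply (is_derive_const 1 t).
  - unfold dphi, plus, zero; simpl. replace (r - 1) with s by (unfold r; ring). field. lra. }
assert (cphi : continuous_pos dphi).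
{ intros t ht. pose proof (Rpower_pos t r).
  apply (continuous_mult (fun t => r * Rpower t s) (fun t => / (1 + Rpower t r) ^ 2)).
  - apply continuous_pos_mult; [apply continuous_pos_const | apply continuous_pos_Rpower | easy].
  - apply (continuous_comp (fun t => Rpower t r) (fun x => / (1 + x) ^ 2)).
    + now apply continuous_pos_Rpower.
    + apply (@ex_derive_continuous R_AbsRing R_NormedModule). auto_derive. nra. }
(* Half of the exponential pays for each factor of the denominator of [dphi]:
   [1 + t^r <= (1 + A) e^(c t / 2)]. *)
assert (hdom : forall t, 0 < t -> f t <= (K * (1 + A) ^ 2 / r) * dphi t).
{ intros t ht. eapply Rle_trans; [now apply hf|]. unfold dphi.
  pose proof (Rpower_pos t r). pose proof (Rpower_pos t s).
  replace (K * (1 + A) ^ 2 / r * (r * Rpower t s / (1 + Rpower t r) ^ 2))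
    with (K * (Rpower t s * ((1 + A) ^ 2 / (1 + Rpower t r) ^ 2))) by (field; lra).
  apply Rmult_le_compat_l; [easy|]. apply Rmult_le_compat_l; [lra|].
  apply Rle_div_r; [nra|].
  specialize (hAt t ht).
  assert (h1 : 1 <= exp (c / 2 * t)).
  { rewrite <- exp_0 at 1. apply exp_le. nra. }
  assert (h2 : exp (- (c * t)) * (exp (c / 2 * t) * exp (c / 2 * t)) = 1).
  { rewrite <- !exp_plus, <- exp_0. f_equal. field. }
  assert (h3 : 1 + Rpower t r <= (1 + A) * exp (c / 2 * t)) by nra.
  pose proof (exp_pos (- (c * t))).
  apply Rle_trans with (exp (- (c * t)) * ((1 + A) * exp (c / 2 * t)) ^ 2).
  - apply Rmult_le_compat_l; [lra|]. apply pow_incr. lra.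
  - replace (exp (- (c * t)) * ((1 + A) * exp (c / 2 * t)) ^ 2) with
      ((1 + A) ^ 2 * (exp (- (c * t)) * (exp (c / 2 * t) * exp (c / 2 * t)))) by ring.
    rewrite h2. lra. }
apply (improper_ex f (K * (1 + A) ^ 2 / r)); [easy|easy|].
intros a b ha hab. set (B := K * (1 + A) ^ 2 / r) in *.
assert (hB : 0 <= B) by (unfold B; apply Rdiv_le_0_compat; [nra|lra]).
apply Rle_trans with (RInt (fun t => B * dphi t) a b).
- apply RInt_le; [easy|now apply ex_RInt_pos| |].
  + apply ex_RInt_pos; [|easy|easy]. apply continuous_pos_mult; [apply continuous_pos_const|easy].
  + intros x hx. apply hdom. lra.
- rewrite (RInt_derive_pos (fun t => B * phi t)).
  + assert (hb : forall t, 0 <= phi t <= 1).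
    { intros t. pose proof (Rpower_pos t r). unfold phi. split.
      - apply Rdiv_le_0_compat; lra.
      - apply Rle_div_l; lra. }
    pose proof (hb a). pose proof (hb b). nra.
  + apply continuous_pos_mult; [apply continuous_pos_const|easy].
  + intros t ht. apply (is_derive_scal phi t B). now apply hphi.
  + easy.
  + easy.
Qed.

(** Makes boundary terms small at both ends: near [0] thanks to [t^s], near infinity thanks to the
    exponential. *)
Lemma Rpower_exp_vanish K s c eps : 0 < s -> 0 < c -> 0 < eps ->
  exists d, 0 < d /\ exists M, forall t, 0 < t -> t < d \/ M < t ->
    K * (Rpower t s * exp (- (c * t))) < eps.
Proof.
intros hs hc heps.
set (K' := Rabs K + 1). assert (hK : K <= K' /\ 0 < K').
{ unfold K'. pose proof (Rle_abs K). pose proof (Rabs_pos K). lra. }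
destruct (Rpower_lt_near0 s (eps / K')) as [d [hd h]]; [easy| apply Rdiv_lt_0_compat; lra|].
destruct (Rpower_le_exp s (c / 2)) as [A [hA hAt]]; [easy|lra|].
(* Half of the exponential absorbs [t^s] and the other half is at most [2 / (c t)], whence
   [K' A (2 / c) / t], which is below [eps] past this threshold. *)
exists d; split; [easy|]. exists (K' * A * (2 / c) / eps).
intros t ht htd.
assert (hp : 0 < Rpower t s * exp (- (c * t))).
{ apply Rmult_lt_0_compat; [apply Rpower_pos | apply exp_pos]. }
apply Rle_lt_trans with (K' * (Rpower t s * exp (- (c * t)))); [nra|].
destruct htd as [htd|htd].
- specialize (h t ht htd).
  assert (he : exp (- (c * t)) <= 1) by (rewrite <- exp_0; apply exp_le; nra).
  pose proof (Rpower_pos t s).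
  apply Rle_lt_trans with (K' * Rpower t s); [apply Rmult_le_compat_l; nra|].
  apply Rmult_lt_reg_r with (/ K'); [apply Rinv_0_lt_compat; lra|].
  replace (K' * Rpower t s * / K') with (Rpower t s) by (field; lra). exact h.
- specialize (hAt t ht).
  assert (hx : 0 < c / 2 * t) by nra.
  assert (he : exp (- (c * t)) * exp (c / 2 * t) = / exp (c / 2 * t)).
  { rewrite <- exp_plus, <- exp_Ropp. f_equal. field. }
  assert (hi : / exp (c / 2 * t) <= / (c / 2 * t)).
  { apply Rinv_le_contravar; [easy|]. pose proof (exp_ineq1_le (c / 2 * t)). lra. }
  assert (h1 : Rpower t s * exp (- (c * t)) <= A * / (c / 2 * t)).
  { pose proof (exp_pos (- (c * t))).
    apply Rle_trans with (A * exp (c / 2 * t) * exp (- (c * t))); [nra|].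
    rewrite Rmult_assoc, (Rmult_comm (exp (c / 2 * t))), he. nra. }
  apply Rle_lt_trans with (K' * (A * / (c / 2 * t))); [nra|].
  replace (K' * (A * / (c / 2 * t))) with (K' * A * (2 / c) / t) by (field; lra).
  apply Rlt_div_l; [easy|]. apply Rlt_div_l in htd; lra.
Qed.

(** Integration by parts without boundary terms: the bound on [G] forces it to vanish at [0] and at
    infinity, so [f1 - f2] has integral zero. *)
Lemma improper_by_parts f1 f2 l1 l2 G K s c : continuous_pos f1 -> continuous_pos f2 ->
  has_improper_integral f1 l1 -> has_improper_integral f2 l2 ->
  (forall t, 0 < t -> is_derive G t (f1 t - f2 t)) -> 0 < s -> 0 < c ->
  (forall t, 0 < t -> Rabs (G t) <= K * (Rpower t s * exp (- (c * t)))) -> l1 = l2.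
Proof.
intros c1 c2 h1 h2 hG hs hc hb.
pose proof (improper_lin f1 f2 l1 l2 1 (-1) c1 c2 h1 h2) as h.
pose proof (continuous_pos_lin f1 f2 1 (-1) c1 c2) as cd.
enough (1 * l1 + -1 * l2 = 0) by lra.
apply (improper_unique _ _ _ cd h).
apply has_improper_integral_RInt; [easy|]. intros eps heps.
destruct (Rpower_exp_vanish K s c (eps / 2)) as [d [hd [M hM]]]; [easy|easy|lra|].
exists d; split; [easy|]. exists M. intros a b ha had hab hbM.
rewrite (RInt_derive_pos G); [|easy| |easy|easy].
2:{ intros t ht. replace (1 * f1 t + -1 * f2 t) with (f1 t - f2 t) by ring. now apply hG. }
assert (hb0 : 0 < b) by lra.
pose proof (hM a ha (or_introl had)). pose proof (hM b hb0 (or_intror hbM)).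
pose proof (hb a ha). pose proof (hb b hb0).
replace (G b - G a - 0) with (G b + - G a) by ring.
eapply Rle_lt_trans; [apply Rabs_triang|]. rewrite Rabs_Ropp. lra.
Qed.

(** * Laguerre polynomials *)

Lemma falling_shift x m : falling (x + 1) (S m) = (x + 1) * falling x m.
Proof.
induction m as [|m IH].
- simpl. ring.
- change (falling (x + 1) (S (S m))) with (falling (x + 1) (S m) * (x + 1 - INR (S m))).
  rewrite IH, S_INR. simpl. ring.
Qed.

Lemma gbinom_absorb x m : INR (S m) * gbinom (x + 1) (S m) = (x + 1) * gbinom x m.
Proof.
unfold gbinom. rewrite falling_shift, fact_simpl, mult_INR.
field. split; [apply INR_fact_neq_0 | apply not_0_INR; lia].
Qed.

Lemma gbinom_shift x m : (x + 1 - INR m) * gbinom (x + 1) m = (x + 1) * gbinom x m.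
Proof.
unfold gbinom. pose proof (falling_shift x m) as h. simpl in h.
unfold Rdiv. rewrite <- !Rmult_assoc, <- h. ring.
Qed.

Definition laguerre_coef (n : nat) (alpha : R) (k : nat) : R :=
  (-1) ^ k * gbinom (INR n + alpha) (n - k) / INR (fact k).

Lemma laguerre_sum n alpha t :
  laguerre n alpha t = sum_f_R0 (fun k => laguerre_coef n alpha k * t ^ k) n.
Proof.
apply sum_eq. intros k _. unfold laguerre_coef. field. apply INR_fact_neq_0.
Qed.

Lemma laguerre_0 alpha t : laguerre 0 alpha t = 1.
Proof. unfold laguerre, gbinom. simpl. field. Qed.

Lemma laguerre_at0 n alpha : laguerre n alpha 0 = gbinom (INR n + alpha) n.
Proof.
rewrite laguerre_sum. destruct n as [|n].
- unfold laguerre_coef, gbinom; simpl; field.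
- rewrite decomp_sum by lia. rewrite (sum_eq _ (fun _ => 0)).
  + rewrite sum_cte. unfold laguerre_coef. rewrite Nat.sub_0_r. simpl. field.
  + intros i _. simpl. ring.
Qed.

Lemma laguerre_coef_derive n alpha k :
  INR (S k) * laguerre_coef (S n) alpha (S k) = - laguerre_coef n (alpha + 1) k.
Proof.
unfold laguerre_coef. rewrite fact_simpl, mult_INR, Nat.sub_succ.
replace (INR (S n) + alpha) with (INR n + (alpha + 1)) by (rewrite S_INR; ring).
simpl ((-1) ^ S k). field. split; [apply INR_fact_neq_0 | apply not_0_INR; lia].
Qed.

(** Compares coefficients of [t^(k+1)] in [laguerre_contiguous], by absorption for binomials. The
    conditional is needed because truncated subtraction gives [laguerre_coef n alpha (S n)] a
    nonzero value. *)
Lemma laguerre_coef_contiguous n alpha k : (k <= n)%nat ->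
  INR (S k) * laguerre_coef (S n) alpha (S k) =
  INR (S n) * laguerre_coef (S n) alpha (S k)
  - (INR n + 1 + alpha) * (if (k =? n)%nat then 0 else laguerre_coef n alpha (S k)).
Proof.
intros hk. destruct (Nat.eqb_spec k n) as [->|hkn]; [ring|].
unfold laguerre_coef. destruct (Nat.le_exists_sub (S k) n) as [m [hm _]]; [lia|].
replace (S n - S k)%nat with (S m) by lia. replace (n - S k)%nat with m by lia.
pose proof (gbinom_absorb (INR n + alpha) m) as h.
replace (INR (S n) + alpha) with (INR n + alpha + 1) by (rewrite S_INR; ring).
assert (hI : INR (S n) = INR (S k) + INR (S m)) by (rewrite <- plus_INR; f_equal; lia).
rewrite hI. pose proof (INR_fact_neq_0 (S k)) as h0.
apply Rmult_eq_reg_r with (INR (fact (S k))); [|easy].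
transitivity ((-1) ^ S k * (INR (S k) * gbinom (INR n + alpha + 1) (S m))); [field; easy|].
transitivity ((-1) ^ S k * (INR (S k) * gbinom (INR n + alpha + 1) (S m) +
  (INR (S m) * gbinom (INR n + alpha + 1) (S m) - (INR n + alpha + 1) * gbinom (INR n + alpha) m)));
  [rewrite h; ring|field; easy].
Qed.

Lemma laguerre_contiguous n alpha t :
  t * laguerre n (alpha + 1) t =
  (INR n + 1 + alpha) * laguerre n alpha t - INR (S n) * laguerre (S n) alpha t.
Proof.
rewrite !laguerre_sum.
rewrite (decomp_sum _ (S n)) by lia. simpl pred.
(* Splits off the constant term and pads the rest with a zero, so that all sums run up to [n]. *)
assert (h : (INR n + 1 + alpha) * sum_f_R0 (fun k => laguerre_coef n alpha k * t ^ k) n =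
  (INR n + 1 + alpha) * laguerre_coef n alpha 0 +
  sum_f_R0 (fun k => (INR n + 1 + alpha) *
    (if (k =? n)%nat then 0 else laguerre_coef n alpha (S k)) * t ^ S k) n).
{ destruct n as [|n]; [simpl; ring|].
  rewrite decomp_sum by lia. simpl pred. rewrite tech5, Nat.eqb_refl.
  rewrite Rmult_0_r, Rmult_0_l, Rplus_0_r, Rmult_plus_distr_l, scal_sum. simpl (t ^ 0).
  f_equal; [ring|]. apply sum_eq. intros k hk.
  destruct (Nat.eqb_spec k (S n)); [lia|ring]. }
rewrite h, Rmult_plus_distr_l, !scal_sum.
(* The constant terms on the right cancel, which leaves a multiple of [t]. *)
assert (h0 : (INR n + 1 + alpha) * laguerre_coef n alpha 0 = INR (S n) * laguerre_coef (S n) alpha 0).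
{ unfold laguerre_coef. rewrite !Nat.sub_0_r.
  pose proof (gbinom_absorb (INR n + alpha) n) as h1.
  replace (INR (S n) + alpha) with (INR n + alpha + 1) by (rewrite S_INR; ring).
  simpl (fact 0). simpl (INR 1). simpl ((-1) ^ 0).
  transitivity ((INR n + alpha + 1) * gbinom (INR n + alpha) n); [field|].
  rewrite <- h1. field. }
rewrite h0. simpl (t ^ 0). rewrite Rmult_1_r.
enough (sum_f_R0 (fun k => (INR n + 1 + alpha) *
    (if (k =? n)%nat then 0 else laguerre_coef n alpha (S k)) * t ^ S k) n =
  sum_f_R0 (fun i => laguerre_coef (S n) alpha (S i) * t ^ S i * INR (S n)) n +
  sum_f_R0 (fun i => laguerre_coef n (alpha + 1) i * t ^ i * t) n) by lra.
rewrite <- sum_plus. apply sum_eq. intros k hk.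
pose proof (laguerre_coef_contiguous n alpha k hk) as h1.
rewrite laguerre_coef_derive in h1.
assert (h2 : (INR n + 1 + alpha) * (if (k =? n)%nat then 0 else laguerre_coef n alpha (S k)) =
  INR (S n) * laguerre_coef (S n) alpha (S k) + laguerre_coef n (alpha + 1) k) by lra.
rewrite h2. simpl. ring.
Qed.

Lemma is_derive_poly a n t :
  is_derive (fun u => sum_f_R0 (fun k => a k * u ^ k) (S n)) t
    (sum_f_R0 (fun k => INR (S k) * a (S k) * t ^ k) n).
Proof.
induction n as [|n IH].
- simpl. auto_derive; [easy|ring].
- rewrite (tech5 _ n).
  apply (is_derive_ext (fun u => sum_f_R0 (fun k => a k * u ^ k) (S n) + a (S (S n)) * u ^ S (S n)));
    [intros u; now rewrite (tech5 _ (S n))|].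
  apply (is_derive_plus (fun u => sum_f_R0 (fun k => a k * u ^ k) (S n))); [easy|].
  evar_last; [apply (is_derive_scal (fun u => u ^ S (S n)));
    apply is_derive_Reals, derivable_pt_lim_pow | simpl pred; ring].
Qed.

Lemma laguerre_derive_sum n alpha t :
  sum_f_R0 (fun k => INR (S k) * laguerre_coef (S n) alpha (S k) * t ^ k) n =
  - laguerre n (alpha + 1) t.
Proof.
rewrite laguerre_sum. replace (- sum_f_R0 (fun k => laguerre_coef n (alpha + 1) k * t ^ k) n)
  with (-1 * sum_f_R0 (fun k => laguerre_coef n (alpha + 1) k * t ^ k) n) by ring.
rewrite scal_sum. apply sum_eq. intros k _. rewrite laguerre_coef_derive. ring.
Qed.

Lemma is_derive_laguerre n alpha t :
  is_derive (laguerre (S n) alpha) t (- laguerre n (alpha + 1) t).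
Proof.
apply (is_derive_ext (fun u => sum_f_R0 (fun k => laguerre_coef (S n) alpha k * u ^ k) (S n)));
  [intros u; now rewrite laguerre_sum|].
rewrite <- laguerre_derive_sum. apply is_derive_poly.
Qed.

Definition dlaguerre (n : nat) (alpha t : R) : R :=
  match n with O => 0 | S m => - laguerre m (alpha + 1) t end.

Lemma is_derive_dlaguerre n alpha t : is_derive (laguerre n alpha) t (dlaguerre n alpha t).
Proof.
destruct n as [|n]; [|apply is_derive_laguerre].
apply (is_derive_ext (fun _ => 1)); [intros u; now rewrite laguerre_0|].
apply (is_derive_const 1 t).
Qed.

(** The operator [t d/dt + (alpha + 1)] multiplies the coefficient of [t^k] by [k + alpha + 1], and
    [gbinom_shift] turns the result into a coefficient with parameter [alpha]. *)
Lemma t_dlaguerre n alpha t :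
  t * dlaguerre n (alpha + 1) t + (alpha + 1) * laguerre n (alpha + 1) t =
  (INR n + 1 + alpha) * laguerre n alpha t.
Proof.
destruct n as [|n].
- rewrite !laguerre_0. simpl. ring.
- simpl dlaguerre. rewrite <- laguerre_derive_sum, !laguerre_sum.
  assert (h : forall k, (k <= S n)%nat -> (INR k + alpha + 1) * laguerre_coef (S n) (alpha + 1) k =
     (INR (S n) + 1 + alpha) * laguerre_coef (S n) alpha k).
  { intros k hk. unfold laguerre_coef.
    pose proof (gbinom_shift (INR (S n) + alpha) (S n - k)) as h.
    rewrite minus_INR in h by easy.
    replace (INR (S n) + (alpha + 1)) with (INR (S n) + alpha + 1) by ring.
    transitivity ((-1) ^ k * ((INR (S n) + alpha + 1 - (INR (S n) - INR k)) *
      gbinom (INR (S n) + alpha + 1) (S n - k)) / INR (fact k)); [field; apply INR_fact_neq_0|].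
    rewrite h. field. apply INR_fact_neq_0. }
  rewrite !scal_sum, (decomp_sum _ (S n)) by lia. rewrite (decomp_sum _ (S n)) by lia.
  simpl pred. pose proof (h 0%nat ltac:(lia)) as h0. simpl (INR 0) in h0.
  assert (hs : forall a b c d e, c = e -> b + d = a -> b + (c + d) = e + a) by (intros; lra).
  apply hs.
  + simpl (t ^ 0). lra.
  + rewrite <- sum_plus. apply sum_eq. intros k hk.
    pose proof (h (S k) ltac:(lia)) as h1. simpl (t ^ S k).
    replace (INR (S k) * laguerre_coef (S n) (alpha + 1) (S k) * t ^ k * t +
      laguerre_coef (S n) (alpha + 1) (S k) * (t * t ^ k) * (alpha + 1)) with
      ((INR (S k) + alpha + 1) * laguerre_coef (S n) (alpha + 1) (S k) * (t * t ^ k)) by ring.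
    rewrite h1. ring.
Qed.

(** The constant depends on [n]: this bound serves for convergence and vanishing boundary terms, not
    for estimates uniform in [n]. *)
Lemma laguerre_exp_bound n alpha c : 0 < c ->
  exists K, 0 <= K /\ forall t, 0 < t -> Rabs (laguerre n alpha t) <= K * exp (c * t).
Proof.
intros hc.
(* Arbitrary coefficients, since those of [laguerre] change with [n] and would block the induction
   on the degree. *)
enough (h : forall a m, exists K, 0 <= K /\ forall t, 0 < t ->
  Rabs (sum_f_R0 (fun k => a k * t ^ k) m) <= K * exp (c * t)).
{ destruct (h (laguerre_coef n alpha) n) as [K [hK hb]]. exists K; split; [easy|].
  intros t ht. rewrite laguerre_sum. now apply hb. }
intros a m. induction m as [|m [K [hK hb]]].
- exists (Rabs (a 0%nat)); split; [apply Rabs_pos|]. intros t ht. simpl.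
  rewrite Rmult_1_r. assert (1 <= exp (c * t)) by (rewrite <- exp_0 at 1; apply exp_le; nra).
  pose proof (Rabs_pos (a 0%nat)). nra.
- destruct (Rpower_le_exp (INR (S m)) c) as [A [hA hAt]]; [apply lt_0_INR; lia|easy|].
  exists (K + Rabs (a (S m)) * A). pose proof (Rabs_pos (a (S m))). split; [nra|].
  intros t ht. rewrite tech5. eapply Rle_trans; [apply Rabs_triang|].
  rewrite Rmult_plus_distr_r. apply Rplus_le_compat; [now apply hb|].
  rewrite Rabs_mult, (Rabs_pos_eq (t ^ S m)) by (apply pow_le; lra).
  rewrite <- Rpower_pow by easy. specialize (hAt t ht). nra.
Qed.

(** * The Gamma function *)

Lemma continuous_pos_expN : continuous_pos (fun t => exp (- t)).
Proof.
apply is_derive_continuous_pos with (fun t => - exp (- t)).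
intros t _. auto_derive; [easy|ring].
Qed.

Lemma continuous_pos_weight alpha : continuous_pos (fun t => Rpower t alpha * exp (- t)).
Proof. apply continuous_pos_mult; [apply continuous_pos_Rpower|apply continuous_pos_expN]. Qed.

Lemma weight_pos alpha t : 0 < Rpower t alpha * exp (- t).
Proof. apply Rmult_lt_0_compat; [apply Rpower_pos|apply exp_pos]. Qed.

(** [Gamma] is defined through a chosen value, so convergence must be established before anything
    can be said about it. *)
Lemma weight_integral alpha : -1 < alpha ->
  has_improper_integral (fun t => Rpower t alpha * exp (- t)) (Gamma (alpha + 1)).
Proof.
intros ha. unfold Gamma. replace (alpha + 1 - 1) with alpha by ring.
destruct (improper_ex_dominated (fun t => Rpower t alpha * exp (- t)) 1 alpha 1) as [l hl].
- apply continuous_pos_weight.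
- intros t _. left. apply weight_pos.
- easy.
- lra.
- intros t _. rewrite !Rmult_1_l. lra.
- rewrite (integral_eq _ l); [easy|apply continuous_pos_weight|easy].
Qed.

Lemma Gamma_pos s : 0 < s -> 0 < Gamma s.
Proof.
intros hs. pose proof (weight_integral (s - 1) ltac:(lra)) as h.
replace (s - 1 + 1) with s in h by ring.
apply Rlt_le_trans with (RInt (fun t => Rpower t (s - 1) * exp (- t)) 1 2).
- apply RInt_gt_0; [lra| |].
  + intros x _. apply weight_pos.
  + intros x hx. apply continuous_pos_weight. lra.
- apply RInt_le_improper; [apply continuous_pos_weight| |easy|lra|lra].
  intros t _. left. apply weight_pos.
Qed.

Lemma Gamma_succ s : 0 < s -> Gamma (s + 1) = s * Gamma s.
Proof.
intros hs. symmetry.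
pose proof (weight_integral (s - 1) ltac:(lra)) as h1.
replace (s - 1 + 1) with s in h1 by ring.
(* A linear combination with second coefficient [0] serves as multiplication by the scalar [s]. *)
pose proof (improper_lin _ _ _ _ s 0 (continuous_pos_weight _) (continuous_pos_weight _) h1 h1) as h2.
pose proof (weight_integral s ltac:(lra)) as h3.
replace (s * Gamma s) with (s * Gamma s + 0 * Gamma s) by ring.
apply (improper_by_parts _ _ _ _ (fun t => Rpower t s * exp (- t)) 1 s 1) with (3 := h2) (4 := h3).
- apply continuous_pos_lin; apply continuous_pos_weight.
- apply continuous_pos_weight.
- intros t ht. evar_last.
  + apply (is_derive_mult (fun u => Rpower u s) (fun u => exp (- u))).
    * now apply is_derive_Rpower.
    * instantiate (1 := - exp (- t)). auto_derive; [easy|ring].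
    * intros; apply Rmult_comm.
  + unfold plus, mult; simpl. ring.
- easy.
- lra.
- intros t _. rewrite Rabs_pos_eq by (left; apply weight_pos). rewrite !Rmult_1_l. lra.
Qed.

(** * The normalisation constants *)

Definition ell_scale (n : nat) (alpha : R) : R := INR (fact n) / Gamma (INR n + alpha + 1).

Lemma INR_alpha_pos n alpha : -1 < alpha -> 0 < INR n + alpha + 1.
Proof. intros. pose proof (pos_INR n). lra. Qed.

Lemma ell_scale_pos n alpha : -1 < alpha -> 0 < ell_scale n alpha.
Proof.
intros ha. apply Rdiv_lt_0_compat; [apply INR_fact_lt_0|].
now apply Gamma_pos, INR_alpha_pos.
Qed.

Lemma ell_scale_S n alpha : -1 < alpha ->
  (INR n + alpha + 1) * ell_scale (S n) alpha = INR (S n) * ell_scale n alpha.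
Proof.
intros ha. pose proof (INR_alpha_pos n alpha ha) as h. unfold ell_scale.
replace (INR (S n) + alpha + 1) with (INR n + alpha + 1 + 1) by (rewrite S_INR; ring).
rewrite Gamma_succ by easy. pose proof (Gamma_pos _ h).
rewrite fact_simpl, mult_INR. field. split; lra.
Qed.

Lemma ell_scale_alpha_succ n alpha : -1 < alpha ->
  (INR n + alpha + 1) * ell_scale n (alpha + 1) = ell_scale n alpha.
Proof.
intros ha. pose proof (INR_alpha_pos n alpha ha) as h. unfold ell_scale.
replace (INR n + (alpha + 1) + 1) with (INR n + alpha + 1 + 1) by ring.
rewrite Gamma_succ by easy. pose proof (Gamma_pos _ h). field. split; lra.
Qed.

Lemma ell_scale_diag n alpha : ell_scale (S n) alpha = INR (S n) * ell_scale n (alpha + 1).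
Proof.
unfold ell_scale. replace (INR (S n) + alpha + 1) with (INR n + (alpha + 1) + 1)
  by (rewrite S_INR; ring).
rewrite fact_simpl, mult_INR. unfold Rdiv. ring.
Qed.

(** The value does not depend on [n]; this makes the pointwise bounds on [ell] near [0] uniform. *)
Lemma ell_scale_laguerre0 n alpha : -1 < alpha ->
  ell_scale n alpha * laguerre n alpha 0 = / Gamma (alpha + 1).
Proof.
intros ha. rewrite laguerre_at0.
pose proof (Gamma_pos (alpha + 1) ltac:(lra)) as h0.
assert (h : Gamma (INR n + alpha + 1) = falling (INR n + alpha) n * Gamma (alpha + 1)).
{ induction n as [|n IH].
  - simpl. rewrite Rplus_0_l. ring.
  - replace (INR (S n) + alpha) with (INR n + alpha + 1) by (rewrite S_INR; ring).
    rewrite falling_shift, Gamma_succ, IH by now apply INR_alpha_pos. ring. }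
pose proof (Gamma_pos _ (INR_alpha_pos n alpha ha)) as h1.
unfold ell_scale, gbinom. rewrite h in *. pose proof (INR_fact_lt_0 n).
field. repeat split; try lra. intros h2. rewrite h2 in h1. lra.
Qed.

Lemma laguerre0_pos n alpha : -1 < alpha -> 0 < laguerre n alpha 0.
Proof.
intros ha. apply Rmult_lt_reg_l with (ell_scale n alpha); [now apply ell_scale_pos|].
rewrite Rmult_0_r, ell_scale_laguerre0 by easy.
apply Rinv_0_lt_compat, Gamma_pos. lra.
Qed.

(** Concavity of [ln]: its tangent at the mean [m] of [x] and [1], with weights [a] and [1 - a],
    lies above it at both points, and the weighted linear terms cancel. *)
Lemma Bernoulli_concave a x : 0 <= a <= 1 -> 0 < x -> Rpower x a <= 1 + a * (x - 1).
Proof.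
intros ha hx. destruct (Req_dec a 1) as [->|ha1]; [rewrite Rpower_1; lra|].
set (m := 1 + a * (x - 1)). assert (hm : 0 < m) by (unfold m; nra).
rewrite <- (exp_ln m) by easy. unfold Rpower. apply exp_le.
pose proof (ln_le_sub1 (x / m) ltac:(now apply Rdiv_lt_0_compat)) as h1.
pose proof (ln_le_sub1 (1 / m) ltac:(apply Rdiv_lt_0_compat; lra)) as h2.
rewrite ln_div in h1 by easy. rewrite ln_div, ln_1 in h2 by lra.
assert (h3 : a * (x / m - 1) + (1 - a) * (1 / m - 1) = 0) by (unfold m; field; fold m; lra).
nra.
Qed.

(** For [-1 < alpha <= 0] the sequence [n^alpha h(n)] is nonincreasing, by the recurrence in [n] and
    Bernoulli's inequality. Larger [alpha] are reached by unit steps. *)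
Lemma ell_scale_bound alpha : -1 < alpha ->
  exists C, 0 < C /\ forall n, (1 <= n)%nat -> ell_scale n alpha <= C * Rpower (INR n) (- alpha).
Proof.
assert (base : forall alpha, -1 < alpha <= 0 ->
  exists C, 0 < C /\ forall n, (1 <= n)%nat -> ell_scale n alpha <= C * Rpower (INR n) (- alpha)).
{ clear alpha. intros alpha ha. exists (ell_scale 1 alpha). split; [now apply ell_scale_pos|].
  intros n hn. induction hn as [|n hn IH].
  - simpl INR. unfold Rpower. rewrite ln_1, Rmult_0_r, exp_0. lra.
  - pose proof (ell_scale_S n alpha ltac:(lra)) as hS.
    pose proof (ell_scale_pos 1 alpha ltac:(lra)) as h1.
    pose proof (lt_0_INR n ltac:(lia)) as hn0.
    set (C := ell_scale 1 alpha) in *.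
    (* The exponent [- alpha] lies in [[0, 1)] and the base is [n / (n+1)]; the right side becomes
       [(n + alpha + 1) / (n + 1)], exactly the ratio in the recurrence. *)
    assert (hB := Bernoulli_concave (- alpha) (INR n / INR (S n)) ltac:(lra)
      ltac:(apply Rdiv_lt_0_compat; [|apply lt_0_INR; lia]; lra)).
    rewrite S_INR in *.
    assert (hq : Rpower (INR n) (- alpha) = Rpower (INR n / (INR n + 1)) (- alpha)
      * Rpower (INR n + 1) (- alpha)).
    { rewrite Rpower_mult_distr; [f_equal; field; lra| |lra]. apply Rdiv_lt_0_compat; lra. }
    assert (hr : (INR n + 1) * (1 + - alpha * (INR n / (INR n + 1) - 1)) = INR n + alpha + 1)
      by (field; lra).
    pose proof (Rpower_pos (INR n + 1) (- alpha)) as hp.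
    apply Rmult_le_reg_l with (INR n + alpha + 1); [lra|]. rewrite hS.
    apply Rle_trans with ((INR n + 1) * (C * Rpower (INR n) (- alpha)));
      [apply Rmult_le_compat_l; lra|].
    rewrite hq.
    replace ((INR n + alpha + 1) * (C * Rpower (INR n + 1) (- alpha))) with
      ((INR n + 1) * (C * ((1 + - alpha * (INR n / (INR n + 1) - 1)) * Rpower (INR n + 1) (- alpha))))
      by (rewrite <- hr; ring).
    apply Rmult_le_compat_l; [lra|]. apply Rmult_le_compat_l; [lra|].
    apply Rmult_le_compat_r; lra. }
assert (gen : forall N alpha, -1 < alpha -> alpha <= INR N ->
  exists C, 0 < C /\ forall n, (1 <= n)%nat -> ell_scale n alpha <= C * Rpower (INR n) (- alpha)).
{ clear alpha. induction N as [|N IH]; intros alpha ha hN.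
  - apply base. simpl in hN. lra.
  - rewrite S_INR in hN. destruct (Rle_dec alpha 0) as [h|h]; [apply base; lra|].
    destruct (IH (alpha - 1)) as [C [hC hb]]; [lra|lra|]. exists C; split; [easy|].
    intros n hn. specialize (hb n hn).
    (* Raising the parameter to [alpha] divides [h] by [n + alpha], which exceeds [n] as
       [alpha > 0], so one more factor [1 / n] is gained. *)
    pose proof (ell_scale_alpha_succ n (alpha - 1) ltac:(lra)) as hS.
    replace (alpha - 1 + 1) with alpha in hS by ring.
    pose proof (lt_0_INR n ltac:(lia)) as hn0.
    pose proof (ell_scale_pos n alpha ha) as hp.
    replace (- (alpha - 1)) with (1 + - alpha) in hb by ring.
    rewrite Rpower_plus, Rpower_1 in hb by easy.
    apply Rmult_le_reg_l with (INR n); [easy|].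
    apply Rle_trans with (ell_scale n (alpha - 1)); [rewrite <- hS; nra|lra]. }
intros ha. destruct (INR_unbounded alpha) as [N hN]. apply (gen N); lra.
Qed.

(** * Orthogonality norm and pointwise bounds *)

(** One step of the Rodrigues formula. After the product rule, [t_dlaguerre] and
    [laguerre_contiguous] eliminate the polynomials of parameter [alpha + 1]. *)
Lemma is_derive_rodrigues n alpha t : 0 < t ->
  is_derive (fun u => Rpower u (alpha + 1) * exp (- u) * laguerre n (alpha + 1) u) t
    (INR (S n) * (Rpower t alpha * exp (- t) * laguerre (S n) alpha t)).
Proof.
intros ht. evar_last.
- apply (is_derive_mult (fun u => Rpower u (alpha + 1) * exp (- u)) (laguerre n (alpha + 1)));
    [|apply is_derive_dlaguerre|intros; apply Rmult_comm].
  apply (is_derive_mult (fun u => Rpower u (alpha + 1)) (fun u => exp (- u))).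
  + now apply is_derive_Rpower.
  + instantiate (1 := - exp (- t)). auto_derive; [easy|ring].
  + intros; apply Rmult_comm.
- unfold plus, mult; simpl. replace (alpha + 1 - 1) with alpha by ring.
  pose proof (Rpower_sub1 t (alpha + 1) ht) as h.
  replace (alpha + 1 - 1) with alpha in h by ring. rewrite <- h.
  pose proof (t_dlaguerre n alpha t) as h1. pose proof (laguerre_contiguous n alpha t) as h2.
  change (match n with 0%nat => 1 | S _ => INR n + 1 end) with (INR (S n)).
  transitivity (Rpower t alpha * exp (- t) *
    (t * dlaguerre n (alpha + 1) t + (alpha + 1) * laguerre n (alpha + 1) t
     - t * laguerre n (alpha + 1) t)); [ring|].
  rewrite h1, h2. ring.
Qed.

Lemma continuous_pos_laguerre n alpha : continuous_pos (laguerre n alpha).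
Proof. apply is_derive_continuous_pos with (dlaguerre n alpha). intros; apply is_derive_dlaguerre. Qed.

Lemma weighted_laguerre2_continuous n alpha :
  continuous_pos (fun t => Rpower t alpha * exp (- t) * laguerre n alpha t ^ 2).
Proof.
apply continuous_pos_mult; [apply continuous_pos_weight|].
simpl. repeat apply continuous_pos_mult; try apply continuous_pos_laguerre. apply continuous_pos_const.
Qed.

(** Induction on [n] for all [alpha]: by the Rodrigues step, one integration by parts reduces
    [(n+1, alpha)] to [(n, alpha+1)] with factor [1 / (n+1)], matched by [ell_scale_diag]. *)
Lemma weighted_laguerre2_integral n alpha : -1 < alpha ->
  has_improper_integral (fun t => Rpower t alpha * exp (- t) * laguerre n alpha t ^ 2)
    (/ ell_scale n alpha).
Proof.
revert alpha. induction n as [|n IH]; intros alpha ha.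
- apply improper_ext with (fun t => Rpower t alpha * exp (- t)).
  + apply continuous_pos_weight.
  + intros t _. rewrite laguerre_0. ring.
  + unfold ell_scale. simpl. rewrite Rplus_0_l. unfold Rdiv.
    rewrite Rmult_1_l, Rinv_inv. now apply weight_integral.
(* Rate [1/4], so that a product of two such bounds still leaves [e^(-t/2)] of the weight. *)
- destruct (laguerre_exp_bound (S n) alpha (/ 4)) as [K [hK hb]]; [lra|].
  destruct (laguerre_exp_bound n (alpha + 1) (/ 4)) as [K' [hK' hb']]; [lra|].
  assert (hE : forall t, exp (- t) * (exp (/ 4 * t) * exp (/ 4 * t)) = exp (- (/ 2 * t))).
  { intros t. rewrite <- !exp_plus. f_equal. lra. }
  destruct (improper_ex_dominated
    (fun t => Rpower t alpha * exp (- t) * laguerre (S n) alpha t ^ 2) (K ^ 2) alpha (/ 2)) as [l hl].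
  + apply weighted_laguerre2_continuous.
  + intros t _. pose proof (weight_pos alpha t). nra.
  + easy.
  + lra.
  + intros t ht. rewrite <- hE.
    replace (K ^ 2 * (Rpower t alpha * (exp (- t) * (exp (/ 4 * t) * exp (/ 4 * t))))) with
      (Rpower t alpha * exp (- t) * (K * exp (/ 4 * t)) ^ 2) by ring.
    apply Rmult_le_compat_l; [left; apply weight_pos|].
    rewrite <- (pow2_abs (laguerre (S n) alpha t)). apply pow_incr.
    split; [apply Rabs_pos|now apply hb].
  + specialize (IH (alpha + 1) ltac:(lra)).
    pose proof (lt_0_INR (S n) ltac:(lia)) as hn.
    pose proof (ell_scale_pos n (alpha + 1) ltac:(lra)) as hs.
    pose proof (improper_lin _ _ _ _ (/ INR (S n)) 0 (weighted_laguerre2_continuous n (alpha + 1))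
      (weighted_laguerre2_continuous n (alpha + 1)) IH IH) as h2.
    replace (/ ell_scale (S n) alpha) with l; [easy|].
    replace (/ ell_scale (S n) alpha) with
      (/ INR (S n) * / ell_scale n (alpha + 1) + 0 * / ell_scale n (alpha + 1)).
    2:{ rewrite ell_scale_diag. field. split; lra. }
    apply (improper_by_parts _ _ _ _
      (fun t => / INR (S n) * (Rpower t (alpha + 1) * exp (- t) * laguerre n (alpha + 1) t
         * laguerre (S n) alpha t)) (/ INR (S n) * (K * K')) (alpha + 1) (/ 2))
      with (3 := hl) (4 := h2).
    * apply weighted_laguerre2_continuous.
    * apply continuous_pos_lin; apply weighted_laguerre2_continuous.
    * intros t ht. evar_last.
      -- apply (is_derive_scal (fun t => Rpower t (alpha + 1) * exp (- t) * laguerre n (alpha + 1) t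
         * laguerre (S n) alpha t)).
         apply (is_derive_mult (fun t => Rpower t (alpha + 1) * exp (- t) * laguerre n (alpha + 1) t)
           (laguerre (S n) alpha)); [now apply is_derive_rodrigues|apply is_derive_laguerre|].
         intros; apply Rmult_comm.
      -- unfold plus, mult; simpl mult; simpl plus.
         change (/ INR (S n) * (INR (S n) * (Rpower t alpha * exp (- t) * laguerre (S n) alpha t)
            * laguerre (S n) alpha t + Rpower t (alpha + 1) * exp (- t) * laguerre n (alpha + 1) t *
              - laguerre n (alpha + 1) t) = 
           Rpower t alpha * exp (- t) * laguerre (S n) alpha t ^ 2 -
           (/ INR (S n) * (Rpower t (alpha + 1) * exp (- t) * laguerre n (alpha + 1) t ^ 2) +
            0 * (Rpower t (alpha + 1) * exp (- t) * laguerre n (alpha + 1) t ^ 2))).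
         field. lra.
    * lra.
    * lra.
    * intros t ht. rewrite !Rabs_mult.
      rewrite (Rabs_pos_eq (/ INR (S n))) by (left; now apply Rinv_0_lt_compat).
      rewrite (Rabs_pos_eq (Rpower t (alpha + 1))) by (left; apply Rpower_pos).
      rewrite (Rabs_pos_eq (exp (- t))) by (left; apply exp_pos).
      rewrite <- hE.
      replace (/ INR (S n) * (K * K') *
        (Rpower t (alpha + 1) * (exp (- t) * (exp (/ 4 * t) * exp (/ 4 * t))))) with
        (/ INR (S n) * (Rpower t (alpha + 1) * exp (- t) * (K' * exp (/ 4 * t))
          * (K * exp (/ 4 * t)))) by ring.
      specialize (hb t ht). specialize (hb' t ht).
      apply Rmult_le_compat_l; [left; now apply Rinv_0_lt_compat|].
      pose proof (weight_pos (alpha + 1) t).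
      apply Rmult_le_compat; [|apply Rabs_pos| |easy].
      -- apply Rmult_le_pos; [lra|apply Rabs_pos].
      -- apply Rmult_le_compat_l; lra.
Qed.

(* The energy [(n+1) L^2 + t L'^2] has derivative [(2t - 2 alpha - 1) L'^2] by the
   Laguerre equation, so [exp (-2t)] times the energy decreases. *)
Lemma laguerre_le_exp n alpha t : - / 2 <= alpha -> 0 <= t ->
  Rabs (laguerre n alpha t) <= laguerre n alpha 0 * exp t.
Proof.
intros ha ht. destruct n as [|n].
{ rewrite !laguerre_0, Rabs_R1, Rmult_1_l. rewrite <- exp_0 at 1. now apply exp_le. }
set (f := laguerre (S n) alpha). set (g := laguerre n (alpha + 1)).
set (dg := dlaguerre n (alpha + 1)). set (N := INR (S n)).
assert (hN : 0 < N) by (apply lt_0_INR; lia).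
set (D := fun u => exp (- 2 * u) * (N * f u ^ 2 + u * g u ^ 2)).
set (dD := fun u => exp (- 2 * u) * (- (2 * alpha + 1) * g u ^ 2 - 2 * N * f u ^ 2)).
assert (hD : forall u, is_derive D u (dD u)).
{ intros u.
  assert (hf : is_derive f u (- g u)) by apply is_derive_laguerre.
  assert (hg : is_derive g u (dg u)) by apply is_derive_dlaguerre.
  (* The Laguerre equation, obtained by eliminating [laguerre n alpha] between the two contiguous
     relations. *)
  assert (hODE : u * dg u = N * f u - (alpha + 1 - u) * g u).
  { pose proof (t_dlaguerre n alpha u) as h1. pose proof (laguerre_contiguous n alpha u) as h2.
    fold g in h1, h2. fold dg in h1. fold f in h2. fold N in h2. lra. }
  unfold D. auto_derive.
  - repeat split; eexists; eassumption.
  - replace (Derive (fun x => f x) u) with (- g u) by (symmetry; now apply is_derive_unique).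
    replace (Derive (fun x => g x) u) with (dg u) by (symmetry; now apply is_derive_unique).
    unfold dD. transitivity (exp (- 2 * u) *
      (-2 * (N * f u ^ 2 + u * g u ^ 2) - 2 * N * f u * g u + g u ^ 2 + 2 * g u * (u * dg u)));
      [ring|]. rewrite hODE. ring. }
assert (hle : D t <= D 0).
{ destruct (MVT_gen D 0 t dD) as [c [_ hc]].
  - intros x _. apply hD.
  - intros x _. apply continuity_pt_filterlim.
    apply (@ex_derive_continuous R_AbsRing R_NormedModule). exists (dD x). apply hD.
  (* The condition [alpha >= -1/2] gives the coefficient of [g^2] its sign. *)
  - assert (dD c <= 0); [|nra]. unfold dD. pose proof (exp_pos (- 2 * c)).
    assert (0 <= (2 * alpha + 1) * g c ^ 2) by (apply Rmult_le_pos; [lra|apply pow2_ge_0]).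
    assert (0 <= N * f c ^ 2) by (apply Rmult_le_pos; [lra|apply pow2_ge_0]).
    nra. }
unfold D in hle. rewrite Rmult_0_r, exp_0, Rmult_0_l, Rplus_0_r, Rmult_1_l in hle.
pose proof (laguerre0_pos (S n) alpha ltac:(lra)) as hf0. fold f in hf0 |- *.
assert (he : exp t * exp t * exp (- 2 * t) = 1) by (rewrite <- !exp_plus, <- exp_0; f_equal; ring).
pose proof (exp_pos t). pose proof (exp_pos (- 2 * t)).
(* The term [t g^2] of the energy is dropped and the factor [e^(-2t)] is undone. *)
assert (h2 : f t ^ 2 <= (f 0 * exp t) ^ 2).
{ apply Rmult_le_reg_l with (N * exp (- 2 * t)); [nra|].
  replace (N * exp (- 2 * t) * (f 0 * exp t) ^ 2) with (N * f 0 ^ 2 * (exp t * exp t * exp (- 2 * t)))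
    by ring. rewrite he.
  assert (0 <= exp (- 2 * t) * (t * g t ^ 2)).
  { apply Rmult_le_pos; [lra|]. apply Rmult_le_pos; [easy|apply pow2_ge_0]. }
  lra. }
rewrite <- (Rabs_pos_eq (f 0 * exp t)) by nra.
apply Rsqr_le_abs_0. unfold Rsqr. lra.
Qed.

(** Mean value theorem on [[0, t]]. The derivative has parameter [alpha + 1 > 0], so
    [laguerre_le_exp] controls it for every [alpha > -1], and the scale cancels its value at [0]. *)
Lemma laguerre_near0 n alpha t : -1 < alpha -> 0 <= t ->
  ell_scale n alpha * Rabs (laguerre n alpha t) <=
  / Gamma (alpha + 1) * (1 + INR n * t * exp t / (alpha + 1)).
Proof.
intros ha ht. pose proof (ell_scale_laguerre0 n alpha ha) as h0.
pose proof (Gamma_pos (alpha + 1) ltac:(lra)) as hG.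
destruct n as [|n].
- rewrite laguerre_0 in *. rewrite Rabs_R1, h0. simpl. unfold Rdiv. lra.
- destruct (MVT_gen (laguerre (S n) alpha) 0 t (fun u => - laguerre n (alpha + 1) u)) as [c [hc hm]].
  + intros x _. apply is_derive_laguerre.
  + intros x _. apply continuity_pt_filterlim.
    apply (@ex_derive_continuous R_AbsRing R_NormedModule).
    exists (- laguerre n (alpha + 1) x). apply is_derive_laguerre.
  + rewrite Rmin_left, Rmax_right in hc by easy.
    pose proof (ell_scale_pos n (alpha + 1) ltac:(lra)) as hs'.
    pose proof (ell_scale_pos (S n) alpha ha) as hs.
    pose proof (lt_0_INR (S n) ltac:(lia)) as hn.
    pose proof (laguerre0_pos (S n) alpha ha) as hp.
    pose proof (laguerre0_pos n (alpha + 1) ltac:(lra)) as hp'.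
    pose proof (laguerre_le_exp n (alpha + 1) c ltac:(lra) ltac:(lra)) as hb.
    pose proof (exp_le c t ltac:(lra)) as hct.
    assert (h1 : Rabs (laguerre (S n) alpha t) <=
      laguerre (S n) alpha 0 + laguerre n (alpha + 1) 0 * exp t * t).
    { replace (laguerre (S n) alpha t) with
        (laguerre (S n) alpha 0 + - laguerre n (alpha + 1) c * t) by lra.
      eapply Rle_trans; [apply Rabs_triang|]. rewrite Rabs_mult, Rabs_Ropp.
      rewrite (Rabs_pos_eq t), (Rabs_pos_eq (laguerre (S n) alpha 0)) by lra.
      apply Rplus_le_compat_l, Rmult_le_compat_r; [easy|]. nra. }
    apply Rle_trans with (ell_scale (S n) alpha *
      (laguerre (S n) alpha 0 + laguerre n (alpha + 1) 0 * exp t * t));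
      [apply Rmult_le_compat_l; lra|].
    rewrite Rmult_plus_distr_l, h0, ell_scale_diag.
    pose proof (ell_scale_laguerre0 n (alpha + 1) ltac:(lra)) as h2.
    rewrite Gamma_succ in h2 by lra.
    right. transitivity (/ Gamma (alpha + 1) + INR (S n) * exp t * t *
      (ell_scale n (alpha + 1) * laguerre n (alpha + 1) 0)); [ring|].
    rewrite h2. field. split; lra.
Qed.

(** * Norms of the functions [ell] *)

Lemma powabs_ge0 x p : 0 <= powabs x p.
Proof. unfold powabs. destruct (Rlt_dec _ _); [left; apply Rpower_pos|lra]. Qed.

Lemma powabs_neq0 x p : x <> 0 -> powabs x p = Rpower (Rabs x) p.
Proof.
intros hx. unfold powabs. destruct (Rlt_dec _ _) as [h|h]; [easy|].
exfalso. apply h. now apply Rabs_pos_lt.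
Qed.

Lemma powabs_0 p : powabs 0 p = 0.
Proof. unfold powabs. rewrite Rabs_R0. destruct (Rlt_dec 0 0); [lra|easy]. Qed.

Lemma powabs_1 x : powabs x 1 = Rabs x.
Proof.
destruct (Req_dec x 0) as [->|h]; [now rewrite powabs_0, Rabs_R0|].
rewrite powabs_neq0 by easy. apply Rpower_1. now apply Rabs_pos_lt.
Qed.

Lemma powabs_le x y p : 0 < p -> 0 < y -> Rabs x <= y -> powabs x p <= Rpower y p.
Proof.
intros hp hy hxy. destruct (Req_dec x 0) as [->|h].
- rewrite powabs_0. left; apply Rpower_pos.
- rewrite powabs_neq0 by easy. apply Rle_Rpower_l; [lra|]. split; [now apply Rabs_pos_lt|easy].
Qed.

Lemma continuous_powabs x p : 0 < p -> continuous (fun y => powabs y p) x.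
Proof.
intros hp. destruct (Req_dec x 0) as [->|hx].
- intros P [eps hP]. rewrite powabs_0 in hP.
  destruct (Rpower_lt_near0 p eps hp (cond_pos eps)) as [d [hd h]].
  exists (mkposreal d hd). intros y hy. apply hP.
  change (Rabs (y - 0) < d) in hy. rewrite Rminus_0_r in hy.
  change (Rabs (powabs y p - 0) < eps).
  rewrite Rminus_0_r, Rabs_pos_eq by apply powabs_ge0.
  destruct (Req_dec y 0) as [->|hy0]; [rewrite powabs_0; apply cond_pos|].
  rewrite powabs_neq0 by easy. apply h; [now apply Rabs_pos_lt|easy].
- assert (hx' : 0 < Rabs x) by now apply Rabs_pos_lt.
  apply (continuous_ext_loc (fun y => powabs y p) (fun y => Rpower (Rabs y) p)).
  + exists (mkposreal (Rabs x) hx'). intros y hy. symmetry. apply powabs_neq0. intros ->.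
    change (Rabs (0 - x) < Rabs x) in hy. rewrite Rminus_0_l, Rabs_Ropp in hy. lra.
  + apply (continuous_comp Rabs (fun y => Rpower y p)); [apply continuous_Rabs|].
    now apply continuous_pos_Rpower.
Qed.

Lemma ell_scaleE n alpha t :
  ell n alpha t = ell_scale n alpha * (Rpower t alpha * exp (- t)) * laguerre n alpha t.
Proof. unfold ell, ell_scale. ring. Qed.

Lemma is_derive_ell n alpha t : 0 < t ->
  is_derive (ell n (alpha + 1)) t (ell (S n) alpha t).
Proof.
intros ht.
assert (hE : forall u, ell_scale n (alpha + 1) *
  (Rpower u (alpha + 1) * exp (- u) * laguerre n (alpha + 1) u) = ell n (alpha + 1) u)
  by (intros u; rewrite ell_scaleE; ring).
apply (is_derive_ext _ _ _ _ hE).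
evar_last; [apply is_derive_scal; now apply is_derive_rodrigues|].
rewrite ell_scaleE, ell_scale_diag. ring.
Qed.

(** Normalised form of [laguerre_contiguous]. At a zero of the polynomial of degree [n+1] the last
    term disappears, which gives the lower bound in (ii). *)
Lemma ell_contiguous n alpha t : -1 < alpha -> 0 < t ->
  ell n (alpha + 1) t = ell n alpha t - ell (S n) alpha t.
Proof.
intros ha ht. rewrite !ell_scaleE, <- (ell_scale_alpha_succ n alpha ha), ell_scale_diag.
pose proof (Rpower_sub1 t (alpha + 1) ht) as h.
replace (alpha + 1 - 1) with alpha in h by ring. rewrite <- h.
transitivity (ell_scale n (alpha + 1) * (Rpower t alpha * exp (- t)) *
  (t * laguerre n (alpha + 1) t)); [ring|].
rewrite laguerre_contiguous. ring.
Qed.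

Lemma continuous_pos_ell n alpha : continuous_pos (ell n alpha).
Proof.
intros t ht. apply (continuous_ext (fun u => ell_scale n alpha *
  (Rpower u alpha * exp (- u)) * laguerre n alpha u)).
- intros u. now rewrite ell_scaleE.
- apply continuous_pos_mult; [|apply continuous_pos_laguerre|easy].
  apply continuous_pos_mult; [apply continuous_pos_const|apply continuous_pos_weight].
Qed.

Lemma continuous_pos_powabs_ell n alpha p : 0 < p ->
  continuous_pos (fun t => powabs (ell n alpha t) p).
Proof.
intros hp t ht. apply (continuous_comp (ell n alpha) (fun x => powabs x p)).
- now apply continuous_pos_ell.
- now apply continuous_powabs.
Qed.

Lemma ell_exp_bound n alpha : -1 < alpha -> exists K, 0 < K /\
  forall t, 0 < t -> Rabs (ell n alpha t) <= K * (Rpower t alpha * exp (- (/ 2 * t))).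
Proof.
intros ha. destruct (laguerre_exp_bound n alpha (/ 2)) as [K [hK hb]]; [lra|].
pose proof (ell_scale_pos n alpha ha) as hs.
exists (ell_scale n alpha * (K + 1)). split; [nra|]. intros t ht.
rewrite ell_scaleE, !Rabs_mult.
rewrite (Rabs_pos_eq (ell_scale n alpha)), (Rabs_pos_eq (Rpower t alpha)),
  (Rabs_pos_eq (exp (- t))) by (left; first [easy|apply exp_pos]).
specialize (hb t ht).
assert (he : exp (- (/ 2 * t)) = exp (- t) * exp (/ 2 * t)) by (rewrite <- exp_plus; f_equal; lra).
rewrite he. pose proof (exp_pos (/ 2 * t)).
replace (ell_scale n alpha * (K + 1) * (Rpower t alpha * (exp (- t) * exp (/ 2 * t)))) with
  (ell_scale n alpha * (Rpower t alpha * exp (- t)) * ((K + 1) * exp (/ 2 * t))) by ring.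
apply Rmult_le_compat_l; [|lra].
left. apply Rmult_lt_0_compat; [easy|apply weight_pos].
Qed.

Lemma Rpower_half_weight t alpha q :
  Rpower (Rpower t alpha * exp (- (/ 2 * t))) q = Rpower t (alpha * q) * exp (- (q / 2 * t)).
Proof.
unfold Rpower. rewrite ln_mult by apply exp_pos. rewrite !ln_exp, <- exp_plus. f_equal. field.
Qed.

Lemma half_weight_pos t alpha : 0 < Rpower t alpha * exp (- (/ 2 * t)).
Proof. apply Rmult_lt_0_compat; apply exp_pos. Qed.

(** The integrand is dominated by a multiple of [t^(alpha p) e^(-p t / 2)], integrable at [0] since
    [alpha p > -1]. *)
Lemma ell_in_Lp n alpha p : -1 < alpha -> 0 < p -> -1 < alpha * p -> in_Lp (ell n alpha) p.
Proof.
intros ha hp hap. destruct (ell_exp_bound n alpha ha) as [K [hK hb]].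
unfold in_Lp. apply (improper_ex_dominated _ (Rpower K p) (alpha * p) (p / 2)).
- now apply continuous_pos_powabs_ell.
- intros t _. apply powabs_ge0.
- easy.
- lra.
- intros t ht. rewrite <- Rpower_half_weight, Rpower_mult_distr; [|easy|apply half_weight_pos].
  apply powabs_le; [easy| |now apply hb].
  apply Rmult_lt_0_compat; [easy|apply half_weight_pos].
Qed.

Lemma Lp_norm_ell n alpha p l : 0 < p ->
  has_improper_integral (fun t => powabs (ell n alpha t) p) l ->
  Lp_norm (ell n alpha) p = powabs l (1 / p).
Proof.
intros hp hl. unfold Lp_norm. now rewrite (integral_eq _ l (continuous_pos_powabs_ell n alpha p hp)).
Qed.

Lemma L1_norm_ell n alpha : -1 < alpha ->
  has_improper_integral (fun t => powabs (ell n alpha t) 1) (Lp_norm (ell n alpha) 1).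
Proof.
intros ha. destruct (ell_in_Lp n alpha 1 ha) as [l hl]; [lra|lra|].
rewrite (Lp_norm_ell n alpha 1 l Rlt_0_1 hl).
replace (1 / 1) with 1 by field. rewrite powabs_1, Rabs_pos_eq; [easy|].
apply (improper_ge0 _ _ (continuous_pos_powabs_ell n alpha 1 Rlt_0_1)) with (2 := hl).
intros; apply powabs_ge0.
Qed.

(** Integrates the derivative from a point near [0], where the primitive is negligible because
    [alpha + 1 > 0]. *)
Lemma ell_le_L1_norm n alpha t : -1 < alpha -> 0 < t ->
  Rabs (ell n (alpha + 1) t) <= Lp_norm (ell (S n) alpha) 1.
Proof.
intros ha ht. pose proof (L1_norm_ell (S n) alpha ha) as hl.
set (l := Lp_norm _ _) in *. apply Rle_plus_epsilon. intros eps heps.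
destruct (ell_exp_bound n (alpha + 1)) as [K [hK hb]]; [lra|].
destruct (Rpower_exp_vanish K (alpha + 1) (/ 2) eps) as [d [hd [M hv]]]; [lra|lra|easy|].
(* Lower end below both [d] and [t], so that the boundary value is less than [eps]. *)
set (a := Rmin (d / 2) t).
assert (h1 : a <= d / 2) by apply Rmin_l. assert (h2 : a <= t) by apply Rmin_r.
assert (h0 : 0 < a) by (apply Rmin_glb_lt; lra).
specialize (hb a h0). specialize (hv a h0 ltac:(left; lra)).
assert (c1 := continuous_pos_ell (S n) alpha).
pose proof (RInt_derive_pos (ell n (alpha + 1)) (ell (S n) alpha) a t c1
  (fun u hu => is_derive_ell n alpha u hu) h0 h2) as hF.
assert (hI : Rabs (RInt (ell (S n) alpha) a t) <= RInt (fun u => powabs (ell (S n) alpha u) 1) a t).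
{ rewrite (RInt_ext (fun u => powabs (ell (S n) alpha u) 1) (fun u => Rabs (ell (S n) alpha u)));
    [|intros; apply powabs_1].
  apply abs_RInt_le; [easy|]. now apply ex_RInt_pos. }
pose proof (RInt_le_improper _ l a t (continuous_pos_powabs_ell (S n) alpha 1 Rlt_0_1)
  (fun _ _ => powabs_ge0 _ _) hl h0 h2) as hle.
replace (ell n (alpha + 1) t) with
  (RInt (ell (S n) alpha) a t + ell n (alpha + 1) a) by (rewrite hF; ring).
eapply Rle_trans; [apply Rabs_triang|]. lra.
Qed.

(** The function is [ell^2 / w], written without a division; see [ell_sq_div]. *)
Lemma weighted_ell2_continuous n alpha : continuous_pos (fun t =>
  ell_scale n alpha ^ 2 * (Rpower t alpha * exp (- t) * laguerre n alpha t ^ 2)).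
Proof.
apply continuous_pos_mult; [apply continuous_pos_const|apply weighted_laguerre2_continuous].
Qed.

Lemma weighted_ell2_integral n alpha : -1 < alpha ->
  has_improper_integral (fun t =>
    ell_scale n alpha ^ 2 * (Rpower t alpha * exp (- t) * laguerre n alpha t ^ 2))
    (ell_scale n alpha).
Proof.
intros ha. pose proof (weighted_laguerre2_integral n alpha ha) as h.
pose proof (weighted_laguerre2_continuous n alpha) as hc.
pose proof (ell_scale_pos n alpha ha).
pose proof (improper_lin _ _ _ _ (ell_scale n alpha ^ 2) 0 hc hc h h) as h2.
replace (ell_scale n alpha ^ 2 * / ell_scale n alpha + 0 * / ell_scale n alpha)
  with (ell_scale n alpha) in h2 by (field; lra).
apply improper_ext with (3 := h2).
- now apply continuous_pos_lin.
- intros t _. simpl. ring.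
Qed.

(** Cauchy-Schwarz in pointwise form: [|ell| <= (q/2) ell^2 / w + w / (2q)]. The choice
    [q = n^(alpha/2)] balances the integrals, as that of [ell^2 / w] is [O(1 / q^2)]. *)
Lemma L1_norm_ell_bound alpha : -1 < alpha -> exists C, 0 < C /\
  forall n, (1 <= n)%nat -> Lp_norm (ell n alpha) 1 <= C / Rpower (INR n) (alpha / 2).
Proof.
intros ha. destruct (ell_scale_bound alpha ha) as [C [hC hb]].
pose proof (Gamma_pos (alpha + 1) ltac:(lra)) as hG.
exists ((C + Gamma (alpha + 1)) / 2). split; [lra|]. intros n hn. specialize (hb n hn).
set (q := Rpower (INR n) (alpha / 2)). assert (hq : 0 < q) by apply Rpower_pos.
assert (hqq : Rpower (INR n) (- alpha) = / (q * q)).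
{ unfold q. rewrite <- Rpower_plus, <- Rpower_Ropp. f_equal. field. }
pose proof (improper_lin _ _ _ _ (q / 2) (/ q / 2) (weighted_ell2_continuous n alpha)
  (continuous_pos_weight alpha) (weighted_ell2_integral n alpha ha) (weight_integral alpha ha)) as h.
apply Rle_trans with (q / 2 * ell_scale n alpha + / q / 2 * Gamma (alpha + 1)).
- apply (improper_le (fun t => powabs (ell n alpha t) 1)) with (5 := h).
  + apply continuous_pos_powabs_ell. lra.
  + apply continuous_pos_lin; [apply weighted_ell2_continuous|apply continuous_pos_weight].
  + intros t ht. rewrite powabs_1, ell_scaleE, !Rabs_mult, <- Rabs_mult.
    pose proof (weight_pos alpha t) as hw. pose proof (ell_scale_pos n alpha ha) as hs.
    rewrite (Rabs_pos_eq (Rpower t alpha * exp (- t))), (Rabs_pos_eq (ell_scale n alpha)) by lra.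
    rewrite <- (pow2_abs (laguerre n alpha t)).
    set (w := Rpower t alpha * exp (- t)) in *. set (s := ell_scale n alpha) in *.
    set (y := Rabs (laguerre n alpha t)).
    (* The slack in the pointwise inequality is half of this square. *)
    assert (0 <= w * / q * (q * s * y - 1) ^ 2).
    { apply Rmult_le_pos; [|apply pow2_ge_0].
      apply Rmult_le_pos; [lra|]. left. now apply Rinv_0_lt_compat. }
    replace (q / 2 * (s ^ 2 * (w * y ^ 2)) + / q / 2 * w) with
      (s * w * y + / 2 * (w * / q * (q * s * y - 1) ^ 2)) by (field; lra).
    lra.
  + now apply L1_norm_ell.
- rewrite hqq in hb.
  apply Rle_trans with (q / 2 * (C * / (q * q)) + / q / 2 * Gamma (alpha + 1)).
  + apply Rplus_le_compat_r, Rmult_le_compat_l; lra.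
  + right. field. lra.
Qed.

(** * Pointwise control of p-th powers and the L^p bound *)

Lemma Rpower_sq_split x p : 0 < x -> Rpower x p = x ^ 2 * Rpower x (p - 2).
Proof.
intros hx. rewrite <- Rpower_pow by easy. rewrite <- Rpower_plus. f_equal. simpl. ring.
Qed.

(** [x^q] is monotone in [x], in a direction set by the sign of [q]; the sum covers both cases. *)
Lemma Rpower_between m x M q : 0 < m -> m <= x -> x <= M ->
  Rpower x q <= Rpower m q + Rpower M q.
Proof.
intros hm hmx hxM. pose proof (Rpower_pos m q). pose proof (Rpower_pos M q).
destruct (Rle_dec 0 q) as [hq|hq].
- assert (Rpower x q <= Rpower M q) by (apply Rle_Rpower_l; lra). lra.
- assert (Rpower x q <= Rpower m q); [|lra].
  replace q with (- - q) by ring. rewrite 2!(Rpower_Ropp _ (- q)).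
  apply Rinv_le_contravar; [apply Rpower_pos|]. apply Rle_Rpower_l; lra.
Qed.

Lemma half_weight_weight t alpha p :
  Rpower (Rpower t alpha * exp (- (/ 2 * t))) (p - 2) * (Rpower t alpha * exp (- t)) =
  Rpower t (alpha * (p - 1)) * exp (- (p / 2 * t)).
Proof. rewrite Rpower_half_weight. unfold Rpower. rewrite <- !exp_plus. f_equal. field. Qed.

(* Where [x] exceeds [mu = t^alpha e^(-t/2)], the factor [x^(p-2)] of [x^p = x^2 x^(p-2)]
   is controlled by its values at [mu] and at the bound [A t^alpha]. *)
Lemma pow_bound_global alpha p A : 1 <= p -> 0 < A -> exists C, 0 < C /\
  forall t x, 0 < t -> 0 < x -> x <= A * Rpower t alpha ->
  Rpower x p <= C * (Rpower t (alpha * p) * exp (- (p / 2 * t))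
                     + x ^ 2 / (Rpower t alpha * exp (- t))).
Proof.
intros hp hA.
destruct (Rpower_le_exp_ge1 (alpha * (p - 1)) (p / 2)) as [K1 [hK1 h1]]; [lra|].
destruct (Rpower_le_exp_ge1 (alpha * (p - 1)) 1) as [K2 [hK2 h2]]; [lra|].
set (C1 := Rpower (A * exp (/ 2)) p). set (C2 := K1 + Rpower A (p - 2) * K2).
assert (hC1 : 0 < C1) by apply Rpower_pos.
assert (hC2 : 0 < C2) by (unfold C2; pose proof (Rpower_pos A (p - 2)); nra).
exists (C1 + 1 + C2). split; [lra|]. intros t x ht hx hxA.
rewrite <- Rpower_half_weight.
set (mu := Rpower t alpha * exp (- (/ 2 * t))).
assert (hmu : 0 < mu) by apply half_weight_pos.
set (w := Rpower t alpha * exp (- t)). assert (hw : 0 < w) by apply weight_pos.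
assert (hmup : 0 < Rpower mu p) by apply Rpower_pos.
assert (hxw : 0 < x ^ 2 / w) by (apply Rdiv_lt_0_compat; [nra|easy]).
(* For [t <= 1] the factor [e^(-t/2)] is at least [e^(-1/2)], so the a priori bound is already a
   multiple of [mu]. *)
destruct (Rle_dec t 1) as [ht1|ht1].
- apply Rle_trans with (C1 * Rpower mu p); [|nra].
  unfold C1. rewrite Rpower_mult_distr; [|pose proof (exp_pos (/ 2)); nra|easy].
  apply Rle_Rpower_l; [lra|]. split; [easy|]. eapply Rle_trans; [exact hxA|].
  unfold mu. replace (A * exp (/ 2) * (Rpower t alpha * exp (- (/ 2 * t)))) with
    (A * Rpower t alpha * (exp (/ 2) * exp (- (/ 2 * t)))) by ring.
  rewrite <- exp_plus. pose proof (Rpower_pos t alpha).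
  assert (1 <= exp (/ 2 + - (/ 2 * t))) by (rewrite <- exp_0 at 1; apply exp_le; lra).
  assert (0 < A * Rpower t alpha) by nra. nra.
- destruct (Rle_dec x mu) as [hxm|hxm].
  + apply Rle_trans with (Rpower mu p); [apply Rle_Rpower_l; lra|]. nra.
  + apply Rle_trans with (C2 * (x ^ 2 / w)); [|nra].
    rewrite Rpower_sq_split by easy.
    replace (C2 * (x ^ 2 / w)) with (x ^ 2 * (C2 / w)) by (field; lra).
    apply Rmult_le_compat_l; [nra|].
    (* Multiplied by [w], both extremes become [t^(alpha (p-1))] times a decaying exponential,
       bounded on [t >= 1] through [K1] and [K2]. *)
    eapply Rle_trans; [apply (Rpower_between mu x (A * Rpower t alpha)); lra|].
    apply Rle_div_r; [easy|]. rewrite Rmult_plus_distr_r. unfold C2.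
    specialize (h1 t ltac:(lra)). specialize (h2 t ltac:(lra)).
    apply Rplus_le_compat.
    * unfold mu, w. rewrite half_weight_weight.
      apply Rle_trans with (K1 * exp (p / 2 * t) * exp (- (p / 2 * t))).
      -- apply Rmult_le_compat_r; [left; apply exp_pos|easy].
      -- rewrite Rmult_assoc, <- exp_plus, Rplus_opp_r, exp_0. lra.
    * rewrite <- Rpower_mult_distr by (try apply Rpower_pos; easy).
      rewrite Rmult_assoc. apply Rmult_le_compat_l; [left; apply Rpower_pos|].
      replace (Rpower (Rpower t alpha) (p - 2) * w) with (Rpower t (alpha * (p - 1)) * exp (- (1 * t))).
      -- apply Rle_trans with (K2 * exp (1 * t) * exp (- (1 * t))).
         ++ apply Rmult_le_compat_r; [left; apply exp_pos|easy].
         ++ rewrite Rmult_assoc, <- exp_plus, Rplus_opp_r, exp_0. lra.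
      -- unfold w. rewrite Rpower_mult, <- Rmult_assoc, <- Rpower_plus. f_equal; f_equal; ring.
Qed.

(** For [t <= 1/N] the hypothesis bounds [x] by a multiple of [mu]. Beyond that the threshold is
    [sqrt N mu]: below it [x^p] is at most [N^(p/2) mu^p], above it [p <= 2] bounds [x^(p-2)] by its
    value at the threshold. *)
Lemma pow_bound_local alpha p A : 1 <= p -> p <= 2 -> alpha <= 0 -> -1 <= alpha * p ->
  0 < A -> exists C, 0 < C /\ forall N t x, 1 <= N -> 0 < t -> 0 < x ->
  (t <= / N -> x <= A * (Rpower t alpha * exp (- (/ 2 * t)))) ->
  Rpower x p <= C * (Rpower N (p / 2) * (Rpower t (alpha * p) * exp (- (p / 2 * t))
                     + Rpower N alpha * (x ^ 2 / (Rpower t alpha * exp (- t))))).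
Proof.
intros hp hp2 hal hap hA. set (C1 := Rpower A p). assert (hC1 : 0 < C1) by apply Rpower_pos.
exists (C1 + 1). split; [lra|]. intros N t x hN ht hx hxA.
rewrite <- Rpower_half_weight.
set (mu := Rpower t alpha * exp (- (/ 2 * t))) in *.
assert (hmu : 0 < mu) by apply half_weight_pos.
set (w := Rpower t alpha * exp (- t)). assert (hw : 0 < w) by apply weight_pos.
assert (hmup : 0 < Rpower mu p) by apply Rpower_pos.
assert (hxw : 0 < x ^ 2 / w) by (apply Rdiv_lt_0_compat; [nra|easy]).
set (Q := Rpower N (p / 2)).
assert (hlnN : 0 <= ln N) by (rewrite <- ln_1; apply ln_le; lra).
assert (hQ : 1 <= Q) by (unfold Q, Rpower; rewrite <- exp_0 at 1; apply exp_le; nra).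
set (P := Rpower N alpha). assert (hP : 0 < P) by apply Rpower_pos.
assert (hPx : 0 < P * (x ^ 2 / w)) by nra.
assert (hQm : Rpower mu p <= Q * Rpower mu p) by nra.
assert (hQx : 0 < Q * (P * (x ^ 2 / w))) by nra.
rewrite Rmult_plus_distr_l.
destruct (Rle_dec t (/ N)) as [htN|htN].
- apply Rle_trans with (C1 * Rpower mu p); [|nra].
  unfold C1. rewrite Rpower_mult_distr by easy.
  apply Rle_Rpower_l; [lra|]. split; [easy|]. now apply hxA.
- set (la := Rpower N (/ 2) * mu).
  assert (hla : 0 < la) by (apply Rmult_lt_0_compat; [apply Rpower_pos|easy]).
  destruct (Rle_dec x la) as [hxl|hxl].
  + apply Rle_trans with (Q * Rpower mu p); [|nra].
    apply Rle_trans with (Rpower la p); [apply Rle_Rpower_l; lra|].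
    right. unfold la, Q. rewrite <- Rpower_mult_distr by (try apply Rpower_pos; easy).
    rewrite Rpower_mult. f_equal. f_equal. field.
  + apply Rle_trans with (Q * (P * (x ^ 2 / w))); [|nra].
    rewrite Rpower_sq_split by easy.
    replace (Q * (P * (x ^ 2 / w))) with (x ^ 2 * (Q * P / w)) by (field; lra).
    apply Rmult_le_compat_l; [nra|].
    apply Rle_trans with (Rpower la (p - 2)).
    { replace (p - 2) with (- (2 - p)) by ring. rewrite !Rpower_Ropp.
      apply Rinv_le_contravar; [apply Rpower_pos|]. apply Rle_Rpower_l; lra. }
    apply Rle_div_r; [easy|]. unfold la.
    rewrite <- Rpower_mult_distr by (try apply Rpower_pos; easy).
    rewrite Rmult_assoc. unfold mu, w. rewrite half_weight_weight, Rpower_mult.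
    unfold Q, P, Rpower. rewrite <- !exp_plus. apply exp_le.
    (* Since [t > 1/N] and [alpha (p-1) <= 0], [t^(alpha (p-1))] is at most [N^(-alpha (p-1))]. The
       exponents of [N] then compare precisely because [-1 <= alpha p]. *)
    assert (hlnt : - ln N <= ln t).
    { rewrite <- ln_Rinv by lra. apply ln_le; [apply Rinv_0_lt_compat; lra|lra]. }
    assert (alpha * (p - 1) * ln t <= - (alpha * (p - 1)) * ln N).
    { assert (0 <= - (alpha * (p - 1))) by nra. nra. }
    assert (0 <= (1 + alpha * p) * ln N) by (apply Rmult_le_pos; lra).
    nra.
Qed.

Lemma ell_sq_div n alpha t :
  Rabs (ell n alpha t) ^ 2 / (Rpower t alpha * exp (- t)) =
  ell_scale n alpha ^ 2 * (Rpower t alpha * exp (- t) * laguerre n alpha t ^ 2).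
Proof.
rewrite pow2_abs, ell_scaleE. pose proof (weight_pos alpha t).
set (w := Rpower t alpha * exp (- t)) in *. field. lra.
Qed.

(** Both ranges of [alpha] are brought to one form, whose integral is [O(n^(p/2))] because
    [n^alpha h(n)] is bounded. *)
Lemma ell_pow_bound alpha p : -1 < alpha -> 1 <= p -> -1 < alpha * p ->
  exists C, 0 < C /\ forall n t, (1 <= n)%nat -> 0 < t ->
  powabs (ell n alpha t) p <= C * Rpower (INR n) (p / 2) *
    (Rpower t (alpha * p) * exp (- (p / 2 * t)) + Rpower (INR n) alpha *
     (ell_scale n alpha ^ 2 * (Rpower t alpha * exp (- t) * laguerre n alpha t ^ 2))).
Proof.
intros ha hp hap.
pose proof (Gamma_pos (alpha + 1) ltac:(lra)) as hG.
set (A := / Gamma (alpha + 1)). assert (hA : 0 < A) by now apply Rinv_0_lt_compat.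
assert (hell : forall n t B, ell_scale n alpha * Rabs (laguerre n alpha t) <= B ->
  Rabs (ell n alpha t) <= B * (Rpower t alpha * exp (- t))).
{ intros n t B hB. rewrite ell_scaleE, !Rabs_mult, <- Rabs_mult.
  pose proof (weight_pos alpha t). pose proof (ell_scale_pos n alpha ha).
  rewrite (Rabs_pos_eq (ell_scale n alpha)), (Rabs_pos_eq (Rpower t alpha * exp (- t))) by lra.
  nra. }
(* Zeros of [ell] are set apart, since [Rpower] differs from [powabs] there. *)
enough (h : exists C, 0 < C /\ forall n t, (1 <= n)%nat -> 0 < t -> ell n alpha t <> 0 ->
  Rpower (Rabs (ell n alpha t)) p <= C * (Rpower (INR n) (p / 2) *
    (Rpower t (alpha * p) * exp (- (p / 2 * t)) + Rpower (INR n) alpha *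
     (Rabs (ell n alpha t) ^ 2 / (Rpower t alpha * exp (- t)))))).
{ destruct h as [C [hC h]]. exists C; split; [easy|]. intros n t hn ht.
  rewrite <- ell_sq_div. destruct (Req_dec (ell n alpha t) 0) as [h0|h0].
  - rewrite h0, powabs_0. pose proof (weight_pos alpha t).
    apply Rmult_le_pos; [left; apply Rmult_lt_0_compat; [easy|apply Rpower_pos]|].
    apply Rplus_le_le_0_compat; [left; apply Rmult_lt_0_compat; apply exp_pos|].
    apply Rmult_le_pos; [left; apply exp_pos|]. apply Rdiv_le_0_compat; [apply pow2_ge_0|easy].
  - rewrite powabs_neq0 by easy. rewrite Rmult_assoc. now apply h. }
destruct (Rle_dec (- / 2) alpha) as [h2|h2].
- destruct (pow_bound_global alpha p A hp hA) as [C [hC h]]. exists C; split; [easy|].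
  intros n t hn ht h0. eapply Rle_trans; [apply h; [exact ht|now apply Rabs_pos_lt|]|].
  + eapply Rle_trans; [apply (hell n t (A * exp t))|].
    (* The growth [e^t] allowed by the energy bound is cancelled by the weight, leaving
       [A t^alpha]. *)
    * pose proof (laguerre_le_exp n alpha t h2 ltac:(lra)) as hb.
      unfold A. rewrite <- (ell_scale_laguerre0 n alpha ha), Rmult_assoc.
      apply Rmult_le_compat_l; [left; now apply ell_scale_pos|easy].
    * right. replace (A * exp t * (Rpower t alpha * exp (- t))) with
        (A * Rpower t alpha * (exp t * exp (- t))) by ring.
      rewrite <- exp_plus, Rplus_opp_r, exp_0. ring.
  + apply Rmult_le_compat_l; [lra|].
    assert (hX : 0 < Rpower t (alpha * p) * exp (- (p / 2 * t)))
      by (apply Rmult_lt_0_compat; apply exp_pos).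
    assert (hY : 0 <= Rabs (ell n alpha t) ^ 2 / (Rpower t alpha * exp (- t)))
      by (apply Rdiv_le_0_compat; [apply pow2_ge_0|apply weight_pos]).
    set (X := Rpower t (alpha * p) * exp (- (p / 2 * t))) in *.
    set (Y := Rabs (ell n alpha t) ^ 2 / (Rpower t alpha * exp (- t))) in *.
    assert (hn1 : 1 <= INR n) by (change 1 with (INR 1); now apply le_INR).
    assert (hln : 0 <= ln (INR n)) by (rewrite <- ln_1; apply ln_le; lra).
    assert (hq1 : 1 <= Rpower (INR n) (p / 2)).
    { unfold Rpower. rewrite <- exp_0 at 1. apply exp_le. nra. }
    (* As [p/2 + alpha >= 0] here, the powers of [n] may be inserted into a bound free of [n]. *)
    assert (hq2 : 1 <= Rpower (INR n) (p / 2) * Rpower (INR n) alpha).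
    { rewrite <- Rpower_plus. unfold Rpower. rewrite <- exp_0 at 1. apply exp_le.
      apply Rmult_le_pos; lra. }
    rewrite Rmult_plus_distr_l, <- Rmult_assoc.
    apply Rplus_le_compat; nra.
(* This follows from [alpha < -1/2] and [alpha p > -1]. *)
- assert (hp2 : p <= 2) by nra.
  (* The bound of [laguerre_near0] when [n t <= 1], hence [e^t <= e]. *)
  set (B := A * (1 + exp 1 / (alpha + 1))).
  assert (hB : 0 < B).
  { unfold B. apply Rmult_lt_0_compat; [easy|].
    assert (0 < exp 1 / (alpha + 1)) by (apply Rdiv_lt_0_compat; [apply exp_pos|lra]). lra. }
  destruct (pow_bound_local alpha p B) as [C [hC h]]; [easy|easy|lra|lra|easy|].
  exists C; split; [easy|]. intros n t hn ht h0.
  assert (hn1 : 1 <= INR n) by (change 1 with (INR 1); now apply le_INR).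
  apply h; [easy|easy|now apply Rabs_pos_lt|].
  intros htn. eapply Rle_trans; [apply (hell n t B)|].
  + eapply Rle_trans; [now apply laguerre_near0; [|left]|].
    fold A. unfold B. apply Rmult_le_compat_l; [lra|]. apply Rplus_le_compat_l.
    apply Rmult_le_compat_r; [left; apply Rinv_0_lt_compat; lra|].
    assert (hnt : INR n * t <= 1).
    { replace 1 with (INR n * / INR n) by (field; lra). apply Rmult_le_compat_l; lra. }
    assert (hnt0 : 0 <= INR n * t) by nra.
    assert (exp t <= exp 1) by (apply exp_le; nra).
    pose proof (exp_pos t). nra.
  + apply Rmult_le_compat_l; [lra|]. apply Rmult_le_compat_l; [left; apply Rpower_pos|].
    apply exp_le. lra.
Qed.

Lemma Lp_norm_ell_bound alpha p : -1 < alpha -> 1 <= p -> -1 < alpha * p ->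
  exists C, 0 < C /\ forall n, (1 <= n)%nat -> Lp_norm (ell n alpha) p <= C * sqrt (INR n).
Proof.
intros ha hp hap. destruct (ell_pow_bound alpha p ha hp hap) as [C [hC hb]].
destruct (ell_scale_bound alpha ha) as [C1 [hC1 hs]].
assert (ck : continuous_pos (fun t => Rpower t (alpha * p) * exp (- (p / 2 * t)))).
{ apply continuous_pos_mult; [apply continuous_pos_Rpower|].
  intros t ht. apply (continuous_ext (fun u => exp (- (p / 2) * u))).
  - intros u. f_equal. ring.
  - now apply continuous_pos_exp. }
assert (pk : forall t, 0 < t -> 0 <= Rpower t (alpha * p) * exp (- (p / 2 * t)))
  by (intros t _; left; apply Rmult_lt_0_compat; apply exp_pos).
destruct (improper_ex_dominated (fun t => Rpower t (alpha * p) * exp (- (p / 2 * t)))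
  1 (alpha * p) (p / 2)) as [k hk]; [easy|easy|easy|lra|intros; lra|].
pose proof (improper_ge0 _ k ck pk hk) as hk0.
(* Here [k] is the integral of the first term of [ell_pow_bound] and [C1] bounds [n^alpha h(n)]; the
   p-th root turns [n^(p/2)] into [sqrt n]. *)
exists (Rpower (C * (k + C1)) (1 / p)). split; [apply Rpower_pos|]. intros n hn.
assert (hn0 : 0 < INR n) by (apply lt_0_INR; lia).
destruct (ell_in_Lp n alpha p ha ltac:(lra) hap) as [l hl].
rewrite (Lp_norm_ell n alpha p l ltac:(lra) hl).
pose proof (improper_ge0 _ l (continuous_pos_powabs_ell n alpha p ltac:(lra))
  (fun _ _ => powabs_ge0 _ _) hl) as hl0.
set (Q := Rpower (INR n) (p / 2)) in *. assert (hQ : 0 < Q) by apply Rpower_pos.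
assert (hle : l <= C * (k + C1) * Q).
{ pose proof (improper_lin _ _ _ _ (C * Q) (C * Q * Rpower (INR n) alpha) ck
    (weighted_ell2_continuous n alpha) hk (weighted_ell2_integral n alpha ha)) as h.
  apply Rle_trans with (C * Q * k + C * Q * Rpower (INR n) alpha * ell_scale n alpha).
  - apply (improper_le (fun t => powabs (ell n alpha t) p)) with (4 := hl) (5 := h).
    + apply continuous_pos_powabs_ell. lra.
    + apply continuous_pos_lin; [easy|apply weighted_ell2_continuous].
    + intros t ht. eapply Rle_trans; [now apply hb|]. right. fold Q. ring.
  - specialize (hs n hn). rewrite Rpower_Ropp in hs.
    pose proof (Rpower_pos (INR n) alpha) as hr.
    assert (Rpower (INR n) alpha * ell_scale n alpha <= C1).
    { replace C1 with (Rpower (INR n) alpha * (C1 * / Rpower (INR n) alpha)) by (field; lra).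
      apply Rmult_le_compat_l; lra. }
    assert (0 < C * Q) by nra. nra. }
assert (hCk : 0 < C * (k + C1)) by nra.
eapply Rle_trans; [apply (powabs_le l (C * (k + C1) * Q))|].
- apply Rdiv_lt_0_compat; lra.
- nra.
- now rewrite Rabs_pos_eq.
- rewrite <- Rpower_mult_distr by easy. right. f_equal.
  unfold Q. rewrite Rpower_mult, <- Rpower_sqrt by easy. f_equal. field. lra.
Qed.

(** The sup norm in (i) and the maximum in (ii) appear as pointwise bounds on [t > 0]: [ell] is
    continuous there, so its essential supremum is its supremum, and all zeros of the polynomial are
    positive for [alpha > -1]. *)
Theorem theorem2p4 (alpha : R) (halpha : -1 < alpha) :
  (* (i) *)
  (0 < alpha -> forall n : nat,
     in_Lp (ell (S n) (alpha - 1)) 1 /\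
     (forall t, 0 < t -> Rabs (ell n alpha t) <= Lp_norm (ell (S n) (alpha - 1)) 1)) /\
  (* (ii) *)
  ((forall n : nat, in_Lp (ell n alpha) 1) /\
   exists C, 0 < C /\ forall n : nat, (1 <= n)%nat ->
     (forall t, 0 < t -> laguerre n alpha t = 0 ->
        Rabs (ell (n - 1) alpha t) <= Lp_norm (ell n alpha) 1) /\
     Lp_norm (ell n alpha) 1 <= C / Rpower (INR n) (alpha / 2)) /\
  (* (iii) *)
  (forall p : R, 1 <= p -> - (1 / p) < alpha ->
     (forall n : nat, in_Lp (ell n alpha) p) /\
     exists C, 0 < C /\ forall n : nat, (1 <= n)%nat ->
       Lp_norm (ell n alpha) p <= C * sqrt (INR n)).
Proof.
split; [|split; [split|]].
- intros ha n. split; [apply ell_in_Lp; lra|]. intros t ht.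
  pose proof (ell_le_L1_norm n (alpha - 1) t ltac:(lra) ht) as h.
  now replace (alpha - 1 + 1) with alpha in h by ring.
- intros n. apply ell_in_Lp; lra.
- destruct (L1_norm_ell_bound alpha halpha) as [C [hC h]]. exists C; split; [easy|].
  intros n hn. split; [|now apply h]. intros t ht hz.
  destruct n as [|n]; [lia|]. replace (S n - 1)%nat with n by lia.
  replace (ell n alpha t) with (ell n (alpha + 1) t); [now apply ell_le_L1_norm|].
  rewrite ell_contiguous by easy. rewrite (ell_scaleE (S n)), hz. ring.
- intros p hp hap.
  assert (h : -1 < alpha * p).
  { apply Rmult_lt_reg_r with (1 / p); [apply Rdiv_lt_0_compat; lra|].
    replace (alpha * p * (1 / p)) with alpha by (field; lra). lra. }
  split; [intros n; apply ell_in_Lp; lra|]. now apply Lp_norm_ell_bound.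
Qed.
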